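(* Let $x^*\in\mathcal M$ be a strict index-$k$ saddle point, and suppose there exist $\delta>0$, $L>\mu>0$ such that for every $x\in U_\delta=\{x\in\mathcal M:d(x,x^* )<\delta\}$ the eigenvalues $\lambda_1\le\dots\le\lambda_{d-m}$ of $\operatorname{Hess}f(x)$ satisfy $$-L\le\lambda_1\le\cdots\le\lambda_k\le-\mu<0<\mu\le\lambda_{k+1}\le\cdots\le\lambda_{d-m}\le L .$$ Consider the iteration with step size $\Delta t>0$ $$x_{n+1}=\mathrm{Ret}_{x_n}\Big(-\Delta t\Big(I-2\sum_{i=1}^kv_n^i(v_n^i)^\top\Big)\operatorname{grad}f(x_n)\Big),$$ where $v_n^1,\dots,v_n^k\in T_{x_n}\mathcal M$ are exact orthonormal eigenvectors of $\operatorname{Hess}f(x_n)$ associated with its $k$ smallest eigenvalues. Then there exists a neighborhood of $x^*$ such that, if the initial point $x_0$ lies in this neighborhood and $\Delta t\le 1/L$, the iterates $x_n$ converge to $x^*$ with a linear convergence rate that depends on the condition number $\kappa=L/\mu$.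
   Context: Let $f:\mathbb{R}^d\to\mathbb{R}$ and $c_1,\dots,c_m:\mathbb{R}^d\to\mathbb{R}$ be smooth, and let $\mathcal M=\{x\in\mathbb{R}^d:c_1(x)=\dots=c_m(x)=0\}$, with $\nabla c_1(x),\dots,\nabla c_m(x)$ linearly independent for every $x\in\mathcal M$. Thus $\mathcal M$ is a smooth $(d-m)$-dimensional embedded submanifold of $\mathbb{R}^d$, equipped with the induced Riemannian metric and geodesic distance $d(\cdot,\cdot)$. $\operatorname{grad}f$ and $\operatorname{Hess}f(x):T_x\mathcal M\to T_x\mathcal M$ are the Riemannian gradient and Hessian of $f$ restricted to $\mathcal M$. A point $x^*\in\mathcal M$ is an index-$k$ saddle point ($k\le d-m-1$) if $\operatorname{grad}f(x^* )=0$ and $\operatorname{Hess}f(x^* )$ has exactly $k$ negative eigenvalues; it is strict if $\operatorname{Hess}f(x^* )$ has no zero eigenvalues. $\mathrm{Ret}$ is a (smooth) retraction: for each $x\in\mathcal M$, $\mathrm{Ret}_x:T_x\mathcal M\to\mathcal M$ satisfies $\mathrm{Ret}_x(0)=x$ and $\frac{d}{dt}\big|_{t=0}\mathrm{Ret}_x(t\eta)=\eta$ for all $\eta\in T_x\mathcal M$. *)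

(* Defs.v *)
(* Vectors of R^d are row vectors, and linear maps act on them by right
   multiplication, as in mxalgebra.                                      *)
From HB Require Import structures.
From mathcomp Require Export all_boot all_order all_algebra.
From mathcomp Require Export all_classical all_reals all_analysis.
Export numFieldNormedType.Exports.

Set Implicit Arguments.
Unset Strict Implicit.
Unset Printing Implicit Defensive.

Import Order.TTheory GRing.Theory Num.Theory.

Local Open Scope classical_set_scope.
Local Open Scope ring_scope.

Section Smoothness.
Context {R : realType} {V W : normedModType R}.

(* For an open set U in a finite-dimensional V this is the class C^n: all
   iterated directional (equivalently, partial) derivatives of order at most
   n exist and are continuous on U.                                          *)
Fixpoint C_class (n : nat) (U : set V) (g : V -> W) : Prop :=
  (forall x, U x -> {for x, continuous g}) /\
  match n with
  | 0 => True
  | n'.+1 => forall v : V,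
      (forall x, U x -> derivable g x v) /\ C_class n' U ('D_v g)
  end.

Definition smooth_on (U : set V) (g : V -> W) : Prop :=
  forall n, C_class n U g.

(* Smoothness on an arbitrary subset S of V: local smooth extendability. *)
Definition smooth_on_subset (S : set V) (g : V -> W) : Prop :=
  forall x, S x -> exists (U : set V) (G : V -> W),
    [/\ open U, U x, smooth_on U G & forall y, U y -> S y -> G y = g y].

End Smoothness.

Section Euclidean.
Context {R : realType} {d : nat}.

(* The library norm on 'rV[R]_d is the sup norm, hence the explicit
   Euclidean structure.                                              *)
Definition dotp (u v : 'rV[R]_d) : R := \sum_(i < d) u 0 i * v 0 i.

Definition enorm (u : 'rV[R]_d) : R := Num.sqrt (dotp u u).

Definition nabla (g : 'rV[R]_d -> R) (x : 'rV[R]_d) : 'rV[R]_d :=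
  \row_(j < d) 'D_(delta_mx 0 j) g x.

Definition orthonormal_family (k : nat) (v : 'I_k -> 'rV[R]_d) : Prop :=
  forall i j, dotp (v i) (v j) = (i == j)%:R.

End Euclidean.

Section Manifold.
Context {R : realType} {d m : nat}.
Variable c : 'I_m -> 'rV[R]_d -> R.

Definition manifold : set 'rV[R]_d := [set x | forall i, c i x = 0].

Definition constraint_grads (x : 'rV[R]_d) : 'M[R]_(m, d) :=
  \matrix_(i < m) nabla (c i) x.

(* The row space of this matrix is T_x M = {eta | <nabla c_i(x), eta> = 0}. *)
Definition tangent (x : 'rV[R]_d) : 'M[R]_d := kermx (constraint_grads x)^T.

(* The orthogonal projector onto T_x M when the constraint gradients are
   linearly independent; see tan_proj_id, tan_proj_sub and tan_proj_sym. *)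
Definition tan_proj (x : 'rV[R]_d) : 'M[R]_d :=
  let A := constraint_grads x in 1%:M - A^T *m invmx (A *m A^T) *m A.

(* Admissible curves are the piecewise C^1 curves in M parametrized by [0, 1]:
   continuous, and C^1 off a finite set s of parameters. One-sided limits of
   the velocity at the break points are not required: this does not change the
   infimum of the lengths.                                                     *)
Definition admissible_curve (x y : 'rV[R]_d) (g : R -> 'rV[R]_d) : Prop :=
  [/\ {within `[0, 1], continuous g},
      forall t : R, `[0, 1]%classic t -> manifold (g t),
      g 0 = x, g 1 = y &
      exists s : seq R, forall t : R, `]0, 1[%classic t -> t \notin s ->
        derivable g t 1 /\ {for t, continuous (derive1 g)}].

Definition curve_length (g : R -> 'rV[R]_d) : \bar R :=
  (\int[lebesgue_measure]_(t in `]0%R, 1%R[) (enorm (derive1 g t))%:E)%E.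

(* +oo when x and y are not joined by any curve in M. *)
Definition geodist (x y : 'rV[R]_d) : \bar R :=
  ereal_inf [set curve_length g | g in admissible_curve x y].

Definition geoball (x : 'rV[R]_d) (r : R) : set 'rV[R]_d :=
  [set y | manifold y /\ (geodist y x < r%:E)%E].

Definition is_retraction (Ret : 'rV[R]_d -> 'rV[R]_d -> 'rV[R]_d) : Prop :=
  [/\ forall x eta, manifold x -> (eta <= tangent x)%MS -> manifold (Ret x eta),
      smooth_on_subset
        [set p : 'rV[R]_d * 'rV[R]_d | manifold p.1 /\ (p.2 <= tangent p.1)%MS]
        (fun p => Ret p.1 p.2),
      forall x, manifold x -> Ret x 0 = x &
      forall x eta, manifold x -> (eta <= tangent x)%MS ->
        is_derive (0 : R) (1 : R) (fun t : R => Ret x (t *: eta)) eta].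

Section RiemannianDerivatives.
Variable f : 'rV[R]_d -> R.

Definition rgrad (x : 'rV[R]_d) : 'rV[R]_d := nabla f x *m tan_proj x.

(* Hess f(x)[eta] = nabla_eta (grad f) = P_x (D (grad f)(x)[eta]) for eta in
   T_x M: the Levi-Civita connection of the induced metric is the tangential
   part of the ambient derivative. The field rgrad is defined on all of R^d and
   is smooth near M. Only the restriction of this matrix to T_x M is
   meaningful.                                                               *)
Definition rhess (x : 'rV[R]_d) : 'M[R]_d := 'J rgrad x *m tan_proj x.

(* lam lists the eigenvalues of Hess f(x) : T_x M -> T_x M in nondecreasing
   order, with multiplicity.                                                *)
Definition hess_spectrum (x : 'rV[R]_d) (lam : (d - m).-tuple R) : Prop :=
  sorted <=%R lam /\
  char_poly (restrictmx (tangent x) (rhess x)) =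
    \prod_(a <- lam) ('X - a%:P).

Definition saddle_point (k : nat) (x : 'rV[R]_d) : Prop :=
  [/\ (k < d - m)%N, manifold x, rgrad x = 0 &
      exists2 lam, hess_spectrum x lam & count (fun a => a < 0) lam = k].

Definition strict_saddle_point (k : nat) (x : 'rV[R]_d) : Prop :=
  saddle_point k x /\ ~~ eigenvalue (restrictmx (tangent x) (rhess x)) 0.

Definition smallest_eigenvectors (k : nat) (x : 'rV[R]_d)
    (v : 'I_k -> 'rV[R]_d) : Prop :=
  [/\ forall i, (v i <= tangent x)%MS, orthonormal_family v &
      exists2 lam, hess_spectrum x lam &
        forall i, v i *m rhess x = lam`_i *: v i].

(* The tangent vector (I - 2 sum_i v^i (v^i)^T) grad f(x), in row form. *)
Definition saddle_direction (k : nat) (x : 'rV[R]_d)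
    (v : 'I_k -> 'rV[R]_d) : 'rV[R]_d :=
  rgrad x *m (1%:M - 2 *: \sum_(i < k) (v i)^T *m v i).

End RiemannianDerivatives.

Lemma tan_proj_sym x : (tan_proj x)^T = tan_proj x.
Proof.
rewrite /tan_proj linearB /= trmx1 !trmx_mul trmxK trmx_inv trmx_mul trmxK.
by rewrite mulmxA.
Qed.

Lemma tan_proj_id x (u : 'rV[R]_d) :
  (u <= tangent x)%MS -> u *m tan_proj x = u.
Proof.
by move=> /sub_kermxP u0; rewrite mulmxBr mulmx1 !mulmxA u0 !mul0mx subr0.
Qed.

Lemma tan_proj_sub x (u : 'rV[R]_d) :
  row_free (constraint_grads x) -> (u *m tan_proj x <= tangent x)%MS.
Proof.
set A := constraint_grads x => Afree; apply/sub_kermxP.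
suff Gu : A *m A^T \in unitmx.
  rewrite -[LHS]mulmxA /tan_proj -/A mulmxBl mul1mx.
  by rewrite -[X in _ - X]mulmxA mulmxKV// subrr mulmx0.
rewrite -row_free_unit -kermx_eq0; apply/rowV0P => w /sub_kermxP wG.
have /rowP wA : w *m A = 0.
  have : w *m A *m (w *m A)^T = 0 by rewrite trmx_mul mulmxA -(mulmxA w) wG mul0mx.
  move/matrixP/(_ 0 0); rewrite !mxE => /eqP.
  under eq_bigr do rewrite [X in _ * X]mxE -expr2.
  rewrite psumr_eq0; last by move=> i _; exact: sqr_ge0.
  move=> /allP H; apply/rowP => j; have := H j (mem_index_enum j).
  by rewrite sqrf_eq0 => /eqP ->; rewrite mxE.
by apply: (row_free_inj Afree); rewrite mul0mx; apply/rowP.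
Qed.

End Manifold.

(* Main.v *)
Require Import Defs.
From HB Require Import structures.
From mathcomp Require Import perm measurable_realfun ring lra.

Set Implicit Arguments.
Unset Strict Implicit.
Unset Printing Implicit Defensive.

Import Order.TTheory GRing.Theory Num.Theory.

Local Open Scope classical_set_scope.
Local Open Scope ring_scope.

(** The linearization at xs of one step of the iteration is I - dt |Hess f(xs)|,
    where |Hess f| has the eigenvectors of Hess f and the absolute values of its
    eigenvalues: the reflection I - 2 sum_i v_i v_i^T changes the sign of the
    negative ones. As these absolute values lie in [mu, L] and dt <= 1/L, the
    linearization contracts the tangent space by 1 - dt mu. The rate obtained is
    1 - dt mu / 2 = 1 - (L dt) / (2 kappa), on a neighborhood that does not
    depend on dt. Since dt may be arbitrarily small, comparing the geodesic and
    the Euclidean distance up to a constant factor close to 1 is not enough; the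
    proof works with lengths of curves instead.

    Fix an iterate x, let S be its reflection matrix, and consider the map
    y |-> Ret_y (- dt (grad f(y) S) P(y)), with P(y) the orthogonal projector
    onto T_y M. It sends the manifold to itself, x to the next iterate and xs to
    xs. Freezing S avoids the regularity of the eigenvectors as functions of the
    point. If this map shrinks tangent vectors near xs by 1 - dt mu / 2, it
    shrinks by this factor the length of any short curve from x to xs, and
    geodist_step follows by taking the infimum over such curves. An iterate at
    small geodesic distance then stays so, the distances decrease
    geometrically, and the Euclidean distance, which is smaller, tends to 0.

    For the shrinking, the differential at y is compared with I - dt A, where
    A = P(x) Hess f(x) S + mu (I - P(x)) extends the flipped Hessian at x to the
    whole space. The matrix A is symmetric with spectrum in [mu, L]
    (flipped_eigenvalue), hence |I - dt A| <= 1 - dt mu (hessian_contraction).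
    This uses that Hess f(x) is symmetric on T_x M (rhess_sym), and that an
    eigenvector orthogonal to v_1, ..., v_k has one of the remaining eigenvalues
    of the list, by comparison of multiplicities in the characteristic
    polynomial (orthogonal_eigenvalue_mem). The difference between the two is at
    most dt times a quantity that tends to 0 at xs (pushed_velocity), by
    continuity of the derivatives of grad f and P and by a Lipschitz bound for
    the derivative of a local extension of the retraction: along the zero
    section that derivative is the identity on tangent vectors, and the
    displacement is dt times a small vector. *)

(** * Euclidean structure and matrix norms *)

Section DotProduct.
Context {R : realType} {d : nat}.
Implicit Types u v w : 'rV[R]_d.

Lemma dotpE u v : dotp u v = (u *m v^T) 0 0.
Proof. by rewrite mxE; apply: eq_bigr => i _; rewrite mxE. Qed.

Lemma dotpC u v : dotp u v = dotp v u.
Proof. by apply: eq_bigr => i _; rewrite mulrC. Qed.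

Lemma dotpDl u v w : dotp (u + v) w = dotp u w + dotp v w.
Proof. by rewrite !dotpE mulmxDl mxE. Qed.

Lemma dotpZl a u w : dotp (a *: u) w = a * dotp u w.
Proof. by rewrite !dotpE -scalemxAl mxE. Qed.

Lemma dotpDr u v w : dotp w (u + v) = dotp w u + dotp w v.
Proof. by rewrite dotpC dotpDl !(dotpC w). Qed.

Lemma dotpZr a u w : dotp w (a *: u) = a * dotp w u.
Proof. by rewrite dotpC dotpZl (dotpC w). Qed.

Lemma dotpNl u w : dotp (- u) w = - dotp u w.
Proof. by rewrite -scaleN1r dotpZl mulN1r. Qed.

Lemma dotpNr u w : dotp w (- u) = - dotp w u.
Proof. by rewrite dotpC dotpNl (dotpC w). Qed.

Lemma dotp0 u : dotp u 0 = 0.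
Proof. by rewrite -[X in dotp _ X](scale0r 0) dotpZr mul0r. Qed.

Lemma dotp_mul (M : 'M[R]_d) u v : dotp (u *m M) v = dotp u (v *m M^T).
Proof. by rewrite !dotpE trmx_mul trmxK mulmxA. Qed.

Lemma dotp_ge0 u : 0 <= dotp u u.
Proof. by apply: sumr_ge0 => i _; rewrite -expr2 sqr_ge0. Qed.

Lemma dotp_eq0 u : (dotp u u == 0) = (u == 0).
Proof.
apply/idP/eqP => [|->]; last by rewrite dotp0.
rewrite psumr_eq0 => [/allP u0|i _]; last by rewrite -expr2 sqr_ge0.
apply/rowP => i; rewrite mxE; apply/eqP.
by have := u0 i (mem_index_enum i); rewrite /= -expr2 sqrf_eq0.
Qed.

Lemma sqr_enorm u : enorm u ^+ 2 = dotp u u.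
Proof. by rewrite sqr_sqrtr // dotp_ge0. Qed.

Lemma enorm_ge0 u : 0 <= enorm u.
Proof. exact: sqrtr_ge0. Qed.

Lemma enorm_le u (a : R) : 0 <= a -> dotp u u <= a ^+ 2 -> enorm u <= a.
Proof.
by move=> a0 ua; rewrite -(ler_pXn2r (n := 2)) ?nnegrE ?enorm_ge0 ?sqr_enorm.
Qed.

Lemma enorm0 : enorm (0 : 'rV[R]_d) = 0.
Proof. by rewrite /enorm dotp0 sqrtr0. Qed.

Lemma enorm_eq0 u : (enorm u == 0) = (u == 0).
Proof. by rewrite -dotp_eq0 -sqr_enorm sqrf_eq0. Qed.

Lemma dotp_le u v : `|dotp u v| <= enorm u * enorm v.
Proof.
have [/eqP|v0] := eqVneq (enorm v) 0.
  by rewrite enorm_eq0 => /eqP ->; rewrite dotp0 normr0 enorm0 mulr0.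
have := dotp_ge0 (enorm v ^+ 2 *: u - dotp u v *: v).
rewrite dotpDl !dotpDr !dotpNl !dotpNr !dotpZl !dotpZr -!sqr_enorm (dotpC v u).
move: v0; rewrite neq_lt ltNge enorm_ge0 /= => v0 H.
rewrite -(ler_pXn2r (n := 2)) ?nnegrE ?mulr_ge0 ?enorm_ge0 //.
rewrite real_normK ?num_real //.
suff : 0 <= enorm v ^+ 2 * ((enorm u * enorm v) ^+ 2 - dotp u v ^+ 2).
  by rewrite pmulr_rge0 ?exprn_gt0 // subr_ge0.
by apply: le_trans H _; rewrite le_eqVlt; apply/orP; left; apply/eqP; ring.
Qed.

Lemma enormD u v : enorm (u + v) <= enorm u + enorm v.
Proof.
apply: enorm_le; first by rewrite addr_ge0 ?enorm_ge0.
rewrite dotpDl !dotpDr (dotpC v u) -!sqr_enorm.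
have := ler_norm (dotp u v); have := dotp_le u v; lra.
Qed.

End DotProduct.

(** Topology and derivatives use the sup norm while lengths use the Euclidean
    one; the two are compared with the crude constant d, whose value is
    irrelevant to the contraction rate. *)
Section MatrixNorm.
Context {R : realType}.

Lemma mx_norm_le m n (M : 'M[R]_(m, n)) (a : R) :
  0 <= a -> (forall i j, `|M i j| <= a) -> `|M| <= a.
Proof.
by move=> a0 Ma; rewrite [leLHS]/Num.norm/= mx_normrE bigmax_le //= => ij _.
Qed.

Lemma entry_le m n (M : 'M[R]_(m, n)) i j : `|M i j| <= `|M|.
Proof.
rewrite [leRHS]/Num.norm/= mx_normrE.
exact: (le_bigmax _ (fun ij => `|M ij.1 ij.2|) (i, j)).
Qed.

Lemma mulmx_norm m n p (A : 'M[R]_(m, n)) (B : 'M[R]_(n, p)) :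
  `|A *m B| <= n%:R * `|A| * `|B|.
Proof.
apply: mx_norm_le => [|i j]; first by rewrite !mulr_ge0.
rewrite mxE; apply: le_trans (ler_norm_sum _ _ _) _.
apply: (@le_trans _ _ (\sum_(l < n) `|A| * `|B|)).
  by apply: ler_sum => l _; rewrite normrM ler_pM // entry_le.
by rewrite sumr_const card_ord mulr_natl mulrnAl.
Qed.

Lemma trmx_norm m n (A : 'M[R]_(m, n)) : `|A^T| <= `|A|.
Proof. by apply: mx_norm_le => // i j; rewrite mxE entry_le. Qed.

Lemma norm_le_enorm d (u : 'rV[R]_d) : `|u| <= enorm u.
Proof.
apply: mx_norm_le => [|i j]; first exact: enorm_ge0.
rewrite ord1 -sqrtr_sqr ler_sqrt ?dotp_ge0 // /dotp (bigD1 j) //= -expr2 lerDl.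
by apply: sumr_ge0 => l _; rewrite -expr2 sqr_ge0.
Qed.

Lemma enorm_le_norm d (u : 'rV[R]_d) : enorm u <= d%:R * `|u|.
Proof.
apply: enorm_le; first by rewrite mulr_ge0.
apply: (@le_trans _ _ (\sum_(l < d) `|u| ^+ 2)).
  apply: ler_sum => l _; rewrite -expr2 -[leLHS]real_normK ?num_real //.
  by rewrite ler_pXn2r ?nnegrE // entry_le.
rewrite sumr_const card_ord -[leLHS]mulr_natl exprMn; apply: ler_wpM2r; first exact: sqr_ge0.
case: d u => [|d] u; first by rewrite expr0n.
by rewrite expr2 ler_peMl // ler1n.
Qed.

End MatrixNorm.

(** * Spectral bounds for symmetric matrices *)

(** In a basis that extends the rows of U, the matrix of h is block
    triangular with diagonal block D: geometric multiplicities are bounded by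
    algebraic ones. *)
Lemma char_poly_stable_dvd (F : fieldType) n p
    (h : 'M[F]_n) (U : 'M[F]_(p, n)) (D : 'M[F]_p) :
  row_free U -> U *m h = D *m U -> char_poly D %| char_poly h.
Proof.
move=> Ufree; have := rank_leq_col U; rewrite (eqP (Ufree : \rank U == p)) => pn.
have [q En] : exists q, n = (p + q)%N by exists (n - p)%N; rewrite subnKC.
subst n; move=> Uh.
set E := row_ebase U; set C := col_ebase U.
have Eu : E \in unitmx by exact: row_ebase_unit.
have Cu : C \in unitmx by exact: col_ebase_unit.
pose J : 'M[F]_(p, p + q) := row_mx 1%:M 0.
have UE : U = C *m J *m E.
  rewrite -[LHS]mulmx_ebase (eqP (Ufree : \rank U == p)); congr (_ *m _ *m _).
  apply/matrixP => i j; rewrite !mxE; case: splitP => l ->.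
    by rewrite !mxE -val_eqE /= ltn_ord andbT.
  by rewrite !mxE /=; case: eqP => //= ->; rewrite ltnNge leq_addr.
pose h' := E *m h *m invmx E.
have Jh' : J *m h' = (invmx C *m D *m C) *m J.
  have -> : J = invmx C *m U *m invmx E.
    by rewrite UE !mulmxA mulVmx // mul1mx mulmxK.
  rewrite /h' !mulmxA mulmxKV // -(mulmxA _ U h) Uh.
  by rewrite -!mulmxA (mulmxA C) mulmxV // mul1mx.
have h'u : usubmx h' = row_mx (invmx C *m D *m C) 0.
  have := Jh'; rewrite -[h' in LHS]vsubmxK mul_row_col mul1mx mul0mx addr0 => ->.
  by rewrite mul_mx_row mulmx1 mulmx0.
have simC : forall r (M X : 'M[F]_r), X \in unitmx ->
    char_poly (X *m M *m invmx X) = char_poly M.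
  move=> r M X Xu; rewrite /char_poly /char_poly_mx.
  have XX : map_mx (@polyC F) X *m map_mx (@polyC F) (invmx X) = 1%:M.
    by rewrite -map_mxM mulmxV // map_mx1.
  have -> : 'X%:M - map_mx (@polyC F) (X *m M *m invmx X) =
      map_mx (@polyC F) X *m ('X%:M - map_mx (@polyC F) M) *m
        map_mx (@polyC F) (invmx X).
    rewrite mulmxBr mulmxBl !map_mxM /=; congr (_ - _).
    by rewrite scalar_mxC -mulmxA XX mulmx1.
  rewrite !det_mulmx mulrAC -[X in _ = X]mul1r; congr (_ * _).
  by rewrite -det_mulmx XX det1.
rewrite -(simC _ h E Eu) -/h' -[h']submxK.
have -> : ulsubmx h' = invmx C *m D *m C by rewrite /ulsubmx h'u row_mxKl.
have -> : ursubmx h' = 0 by rewrite /ursubmx h'u row_mxKr.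
rewrite /char_poly /char_poly_mx map_block_mx /= raddf0.
have -> : ('X%:M : 'M[{poly F}]_(p + q)) = block_mx 'X%:M 0 0 'X%:M.
  by rewrite scalar_mx_block.
rewrite opp_block_mx add_block_mx subr0 det_lblock.
rewrite -[X in _ %| X * _]/(char_poly (invmx C *m D *m C)).
by rewrite -[X in _ *m X](invmxK C) simC ?unitmx_inv // dvdp_mulr.
Qed.

(** Along the line c - t cC the quadratic form is -2t |cC|^2 + O(t^2), which
    would be negative for small t > 0 if cC were not zero. *)
Lemma psd_kernel (R : realType) d (C : 'M[R]_d) (c : 'rV[R]_d) :
  C^T = C -> (forall u, 0 <= dotp (u *m C) u) -> dotp (c *m C) c = 0 ->
  c *m C = 0.
Proof.
move=> Cs C0 c0; set v := c *m C.
have vC : dotp (v *m C) c = dotp v v by rewrite dotp_mul Cs.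
apply/eqP; rewrite -dotp_eq0; apply/negPn/negP => v0.
have a0 : 0 < dotp v v by rewrite lt_neqAle eq_sym v0 dotp_ge0.
have b0 := C0 v.
set a := dotp v v in vC v0 a0; set b := dotp (v *m C) v in b0.
have ab : 0 < a + b by rewrite ltr_pwDl.
(* a / (a + b) makes the linear term dominate whatever the value of b *)
have := C0 (c - (a / (a + b)) *: v).
rewrite mulmxBl -scalemxAl -/v dotpDl !dotpDr !dotpNl !dotpNr !dotpZl !dotpZr.
rewrite c0 -/a -/b vC; set t := a / (a + b).
have ht : t * (a + b) = a by rewrite /t mulrVK // unitfE gt_eqF.
have t0 : 0 < t by rewrite divr_gt0.
clearbody t; have t1 : 0 < t * a by rewrite mulr_gt0.
have : 0 < t * (t * a) by rewrite mulr_gt0.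
have -> : t * (t * a) = t * (a - t * b) by congr (_ * _); lra.
lra.
Qed.

Lemma continuous_sum (R : realType) (T : topologicalType) n (F : 'I_n -> T -> R) x :
  (forall i, {for x, continuous (F i)}) ->
  {for x, continuous (fun y => \sum_(i < n) F i y)}.
Proof.
move=> cF; apply: (cvg_big (op := +%R)) => [|i _]; last exact: cF.
exact: add_continuous.
Qed.

Lemma continuous_dotp_mul (R : realType) d (M : 'M[R]_d) :
  continuous (fun u : 'rV[R]_d => dotp (u *m M) (u *m M)).
Proof.
have cM j : continuous (fun u : 'rV[R]_d => (u *m M) 0 j).
  move=> u; under eq_fun do rewrite mxE.
  apply: continuous_sum => i.
  by apply: continuousM; [exact: coord_continuous|exact: cst_continuous].
move=> u; apply: continuous_sum => i.
by apply: continuousM; exact: cM.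
Qed.

(** The maximum c of |uB| on the unit sphere satisfies c B^2 = M c, and
    factoring B^2 - M over the square roots of M exhibits an eigenvector of B
    whose eigenvalue has modulus sqrt M. *)
Lemma symmetric_enorm_le (R : realType) d (B : 'M[R]_d) (q : R) :
  B^T = B -> 0 <= q ->
  (forall a (w : 'rV[R]_d), w != 0 -> w *m B = a *: w -> `|a| <= q) ->
  forall u, enorm (u *m B) <= q * enorm u.
Proof.
move=> Bs q0 Bq u.
have [->|u0] := eqVneq u 0; first by rewrite mul0mx enorm0 mulr0.
pose f (x : 'rV[R]_d) := dotp (x *m B) (x *m B).
pose A := [set x : 'rV[R]_d | dotp x x = 1].
have unitA (x : 'rV[R]_d) : x != 0 -> A ((enorm x)^-1 *: x).
  move=> x0; rewrite /A /= dotpZl dotpZr mulrA -expr2 -sqr_enorm exprVn mulVf //.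
  by rewrite sqrf_eq0 enorm_eq0.
have Acl : closed A.
  have -> : A = (fun x : 'rV[R]_d => dotp (x *m 1%:M) (x *m 1%:M)) @^-1` [set 1].
    by apply/seteqP; split => x; rewrite /A /= mulmx1.
  apply: closed_comp; last exact: closed_eq.
  by move=> x _; exact: continuous_dotp_mul.
have Abd : bounded_set A.
  exists 1; split => // M M1 x Ax; apply: le_trans (ltW M1).
  by apply: le_trans (norm_le_enorm _) _; rewrite /enorm Ax sqrtr1.
have Aco := bounded_closed_compact Abd Acl.
have fc : {within A, continuous f}.
  by apply: continuous_subspaceT; exact: continuous_dotp_mul.
have [c cA cmax] := EVT_max_rV (ex_intro _ _ (unitA _ u0)) Aco fc.
move: cA; rewrite inE => cA.
set M := f c in cmax; have M0 : 0 <= M by exact: dotp_ge0.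
have fM x : f x <= M * dotp x x.
  have [->|x0] := eqVneq x 0; first by rewrite /f mul0mx dotp0 mulr0.
  have e0 : 0 < enorm x by rewrite lt_neqAle eq_sym enorm_eq0 x0 enorm_ge0.
  have := cmax _ (mem_set (unitA _ x0)).
  rewrite /f -scalemxAl dotpZl dotpZr mulrA -expr2 -/(f x) exprVn.
  by rewrite mulrC ler_pdivrMr ?exprn_gt0 // sqr_enorm.
have cM : c *m (M%:M - B *m B) = 0.
  apply: psd_kernel => [|x|].
  - by rewrite linearB /= tr_scalar_mx trmx_mul Bs.
  - rewrite mulmxBr mul_mx_scalar mulmxA dotpDl dotpNl dotpZl dotp_mul Bs.
    by rewrite subr_ge0; exact: fM.
  rewrite mulmxBr mul_mx_scalar mulmxA dotpDl dotpNl dotpZl (dotp_mul B) Bs.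
  by rewrite cA mulr1 subrr.
have c0 : c != 0.
  by rewrite -dotp_eq0 cA oner_eq0.
have {cM} cBB : c *m B *m B = M *: c.
  move/eqP: cM; rewrite mulmxBr mul_mx_scalar mulmxA subr_eq0.
  by move/eqP.
pose s := Num.sqrt M; have s0 : 0 <= s by exact: sqrtr_ge0.
have sM : s * s = M by rewrite -expr2 sqr_sqrtr.
have sq : s <= q.
  have [w0|w0] := eqVneq (c *m B + s *: c) 0.
    have := Bq (- s) c c0; rewrite normrN ger0_norm //; apply.
    by apply/eqP; rewrite scaleNr -addr_eq0 w0.
  rewrite -[s]ger0_norm //; apply: (Bq _ _ w0).
  by rewrite mulmxDl cBB -scalemxAl scalerDr scalerA sM addrC.
apply: enorm_le; first by rewrite mulr_ge0 ?enorm_ge0.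
apply: le_trans (fM u) _; rewrite exprMn sqr_enorm -sM -expr2.
by apply: ler_wpM2r; rewrite ?dotp_ge0 // ler_pXn2r.
Qed.

Section Reflection.
Context {R : realType} {d k : nat}.
Variables (P H : 'M[R]_d) (v : 'I_k -> 'rV[R]_d) (l : 'I_k -> R) (mu L : R).
Hypotheses (Psym : P^T = P) (PP : P *m P = P) (HP : H *m P = H).
Hypothesis Hsym : forall u w : 'rV[R]_d, u *m P = u -> w *m P = w ->
  dotp (u *m H) w = dotp u (w *m H).
Hypotheses (vP : forall i, v i *m P = v i) (vON : orthonormal_family v).
Hypothesis (vH : forall i, v i *m H = l i *: v i).
Hypotheses (mu0 : 0 < mu) (muL : mu <= L).
Hypothesis lneg : forall i, - L <= l i <= - mu.
Hypothesis wpos : forall a (w : 'rV[R]_d), w != 0 -> w *m P = w ->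
  w *m H = a *: w -> (forall i, dotp w (v i) = 0) -> mu <= a <= L.

Definition reflection : 'M[R]_d := 1%:M - 2 *: \sum_(i < k) (v i)^T *m v i.

Let Q : 'M[R]_d := \sum_(i < k) (v i)^T *m v i.
Let K := P *m H.

Let mulQ (w : 'rV[R]_d) : w *m Q = \sum_(i < k) dotp w (v i) *: v i.
Proof.
rewrite mulmx_sumr; apply: eq_bigr => i _; rewrite mulmxA dotpE.
by rewrite -mul_scalar_mx; congr (_ *m _); apply: mx11_scalar.
Qed.

Let Qsym : Q^T = Q.
Proof.
by rewrite /Q raddf_sum /=; apply: eq_bigr => i _; rewrite trmx_mul trmxK.
Qed.

Lemma reflection_sym : reflection^T = reflection.
Proof. by rewrite /reflection linearB linearZ /= trmx1 -/Q Qsym. Qed.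

Lemma reflection_comm : reflection *m P = P *m reflection.
Proof.
have QP : Q *m P = Q.
  by rewrite /Q mulmx_suml; apply: eq_bigr => i _; rewrite -mulmxA vP.
have PQ : P *m Q = Q by rewrite -[LHS]trmxK trmx_mul Qsym Psym QP Qsym.
by rewrite /reflection -/Q mulmxBl mulmxBr mulmx1 mul1mx -scalemxAl -scalemxAr QP PQ.
Qed.

Let Ksym : K^T = K.
Proof.
apply/matrixP => i j; rewrite mxE.
have KE (a b : 'I_d) : K a b = dotp (delta_mx 0 a *m K) (delta_mx 0 b).
  by rewrite dotpE trmx_delta -rowE -colE !mxE.
rewrite !KE; have -> : K = P *m H *m P by rewrite /K -mulmxA HP.
rewrite !mulmxA !(dotp_mul P) Psym.
by rewrite Hsym -?mulmxA ?PP // dotpC.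
Qed.

Let vK i : v i *m K = l i *: v i.
Proof. by rewrite /K mulmxA vP vH. Qed.

Let QK : Q *m K = K *m Q.
Proof.
rewrite -[RHS]trmxK trmx_mul Ksym Qsym /Q mulmx_suml raddf_sum /=.
apply: eq_bigr => i _; rewrite -!mulmxA vK -scalemxAr linearZ /=.
by rewrite trmx_mul trmxK.
Qed.

Let wS (w : 'rV[R]_d) i : dotp (w *m reflection) (v i) = - dotp w (v i).
Proof.
rewrite /reflection -/Q mulmxBr mulmx1 -scalemxAr dotpDl dotpNl dotpZl.
suff -> : dotp (w *m Q) (v i) = dotp w (v i) by ring.
rewrite dotp_mul Qsym mulQ (bigD1 i) //= vON eqxx scale1r big1 ?addr0 //.
by move=> j ji; rewrite vON eq_sym (negbTE ji) scale0r.
Qed.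

(** The reflection flips the sign of the negative eigenvalues of H, and the
    term mu (1 - P) puts the normal directions at the bottom of the positive
    range, so that the whole spectrum lies in [mu, L]. *)
Definition flipped : 'M[R]_d := P *m H *m reflection + mu *: (1%:M - P).

Lemma flipped_sym : flipped^T = flipped.
Proof.
rewrite /flipped [(_ + _)^T]linearD /= [(_ *: _)^T]linearZ /=.
rewrite [(_ - _)^T]linearB /= trmx1 Psym -/K trmx_mul.
rewrite reflection_sym Ksym; congr (_ + _).
by rewrite /reflection -/Q mulmxBl mulmxBr mulmx1 mul1mx -scalemxAl -scalemxAr QK.
Qed.

(** The normal part of an eigenvector forces the eigenvalue mu. A tangent
    eigenvector w that is not orthogonal to some v i has eigenvalue - l i, by
    symmetry of H; otherwise it is fixed by the reflection, hence is an
    eigenvector of H itself. *)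
Lemma flipped_eigenvalue a (w : 'rV[R]_d) :
  w != 0 -> w *m flipped = a *: w -> mu <= a <= L.
Proof.
move=> w0 wa; have SP := reflection_comm.
have PZ : (1%:M - P) *m (1%:M - P) = 1%:M - P.
  by rewrite mulmxBl mul1mx mulmxBr mulmx1 PP subrr subr0.
have ZZ : P *m (1%:M - P) = 0 by rewrite mulmxBr mulmx1 PP subrr.
have [wP0|wP0] := eqVneq (w *m (1%:M - P)) 0; last first.
  suff -> : a = mu by rewrite lexx.
  have : w *m flipped *m (1%:M - P) = a *: (w *m (1%:M - P)).
    by rewrite wa -scalemxAl.
  have -> : w *m flipped *m (1%:M - P) = mu *: (w *m (1%:M - P)).
    rewrite /flipped -mulmxA [X in w *m X]mulmxDl -scalemxAl PZ.
    have -> : P *m H *m reflection *m (1%:M - P) = 0.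
      by rewrite -{1}HP mulmxA -(mulmxA _ P) -SP -!mulmxA ZZ !mulmx0.
    by rewrite add0r scalemxAr.
  move=> /eqP; rewrite -subr_eq0 -scalerBl scaler_eq0.
  by rewrite (negbTE wP0) orbF subr_eq0 => /eqP.
have {wP0} wP : w *m P = w.
  by move/eqP: wP0; rewrite mulmxBr mulmx1 subr_eq0 => /eqP.
have {}wa : w *m H *m reflection = a *: w.
  have wZ : w *m (1%:M - P) = 0 by rewrite mulmxBr mulmx1 wP subrr.
  by move: wa; rewrite /flipped mulmxDr -[X in _ + X]scalemxAr wZ scaler0 addr0
    !mulmxA wP.
have S2 : reflection *m reflection = 1%:M.
  have Q2 : Q *m Q = Q.
    rewrite {1}/Q mulmx_suml; apply: eq_bigr => i _; rewrite -mulmxA mulQ.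
    rewrite (bigD1 i) //= vON eqxx scale1r big1 ?addr0 // => j ji.
    by rewrite vON eq_sym (negbTE ji) scale0r.
  rewrite /reflection -/Q mulmxBl mul1mx -scalemxAl mulmxBr mulmx1 -scalemxAr Q2.
  by apply/matrixP => i j; rewrite !mxE; ring.
have {}wa : w *m H = a *: (w *m reflection).
  by rewrite scalemxAl -wa -!mulmxA S2 mulmx1.
have orth i : (l i + a) * dotp w (v i) = 0.
  have := Hsym wP (vP i); rewrite wa dotpZl wS vH dotpZr => e.
  by rewrite mulrDl -e; ring.
have [[i wi]|wi] := pselect (exists i, dotp w (v i) != 0).
  have /eqP := orth i; rewrite mulf_eq0 (negbTE wi) orbF addrC addr_eq0 => /eqP ->.
  by have /andP[h1 h2] := lneg i; rewrite lerNr h2 lerNl h1.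
have {}wi i : dotp w (v i) = 0.
  by apply/eqP/negPn/negP => e; apply: wi; exists i.
apply: (wpos w0 wP _ wi); rewrite wa; congr (_ *: _).
rewrite /reflection -/Q mulmxBr mulmx1 -scalemxAr mulQ big1 ?scaler0 ?subr0 //.
by move=> i _; rewrite wi scale0r.
Qed.

Lemma flipped_contraction (t : R) (u : 'rV[R]_d) : 0 <= t -> t * L <= 1 ->
  enorm (u *m (1%:M - t *: flipped)) <= (1 - t * mu) * enorm u.
Proof.
move=> t0 tL; have tmu : t * mu <= t * L by rewrite ler_wpM2l.
apply: symmetric_enorm_le => [||a w w0 wa].
- by rewrite [LHS]linearB /= [(_ *: _)^T]linearZ /= trmx1 flipped_sym.
- by rewrite subr_ge0 (le_trans tmu).
have [t1|t1] := eqVneq t 0.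
  move/eqP: wa; rewrite t1 scale0r subr0 mulmx1 -[X in X == _]scale1r -subr_eq0.
  rewrite -scalerBl scaler_eq0 (negbTE w0) orbF subr_eq0 => /eqP <-.
  by rewrite mul0r subr0 normr1.
have /(flipped_eigenvalue w0) : w *m flipped = ((1 - a) / t) *: w.
  have : t *: (w *m flipped) = (1 - a) *: w.
    rewrite scalerBl scale1r -wa mulmxBr mulmx1 -scalemxAr.
    by rewrite opprB addrC subrK.
  by move=> e; rewrite mulrC -scalerA -e scalerA mulVf // scale1r.
have tp : 0 < t by rewrite lt_neqAle eq_sym t1.
rewrite ler_pdivlMr // ler_pdivrMr // (mulrC mu) (mulrC L) => /andP[h1 h2].
by rewrite ler_norml; apply/andP; split; lra.
Qed.

End Reflection.

(** Together with the given ones, an eigenvector orthogonal to the first k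
    eigenvectors spans a stable subspace of dimension k + 1, so that its
    eigenvalue occurs among the remaining roots of the characteristic
    polynomial. *)
Lemma orthogonal_eigenvalue_mem (R : realType) d r (T H : 'M[R]_d) (k : nat)
    (v : 'I_k -> 'rV[R]_d) (lam : r.-tuple R) a (w : 'rV[R]_d) :
  stablemx T H ->
  char_poly (restrictmx T H) = \prod_(b <- lam) ('X - b%:P) ->
  (k < r)%N ->
  (forall i, (v i <= T)%MS) -> orthonormal_family v ->
  (forall i, v i *m H = lam`_i *: v i) ->
  w != 0 -> (w <= T)%MS -> w *m H = a *: w -> (forall i, dotp w (v i) = 0) ->
  a \in drop k lam.
Proof.
move=> TH ch kr vT vON vH w0 wT wH wv.
pose V : 'M[R]_(k + 1, d) := col_mx (\matrix_i v i) w.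
pose D : 'M[R]_(k + 1) := diag_mx (row_mx (\row_(i < k) lam`_i) a%:M).
have VT : (V <= row_base T)%MS.
  rewrite eq_row_base; apply/row_subP => i; rewrite /V.
  by case: (split_ordP i) => j ->; rewrite ?rowKu ?rowKd ?rowK // row_id.
have VH : V *m H = D *m V.
  apply/row_matrixP => i; rewrite !row_mul row_diag_mx -scalemxAl -rowE.
  rewrite /V; case: (split_ordP i) => j ->.
    by rewrite rowKu rowK row_mxEl mxE vH.
  by rewrite rowKd row_id ord1 row_mxEr wH !mxE eqxx mulr1n.
pose U := V *m pinvmx (row_base T).
have UV : U *m row_base T = V by rewrite /U mulmxKpV.
have Vfree : row_free V.
  rewrite -kermx_eq0; apply/rowV0P => x /sub_kermxP xV.
  have xG : x *m (V *m V^T) = 0 by rewrite mulmxA xV mul0mx.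
  have G : V *m V^T = block_mx 1%:M 0 0 (dotp w w)%:M.
    rewrite /V tr_col_mx mul_col_row; congr block_mx.
    - apply/matrixP => i j; rewrite [RHS]mxE -[RHS]vON [LHS]mxE.
      by apply: eq_bigr => t _; rewrite !mxE.
    - apply/matrixP => i j; rewrite [RHS]mxE -[RHS](wv i) dotpC [LHS]mxE.
      by apply: eq_bigr => t _; rewrite !mxE ord1.
    - apply/matrixP => i j; rewrite [RHS]mxE -[RHS](wv j) [LHS]mxE.
      by apply: eq_bigr => t _; rewrite !mxE ord1.
    - by apply/matrixP => i j; rewrite !ord1 dotpE !mxE eqxx mulr1n.
  move: xG; rewrite G -[x]hsubmxK mul_row_block !mulmx0 mulmx1 addr0 add0r.
  rewrite mul_mx_scalar -row_mx0 => /eq_row_mx[-> /eqP].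
  by rewrite scaler_eq0 dotp_eq0 (negbTE w0) => /eqP ->.
have Ufree : row_free U.
  rewrite -kermx_eq0; apply/rowV0P => x /sub_kermxP xU.
  by apply: (row_free_inj Vfree); rewrite /= mul0mx -UV mulmxA xU mul0mx.
have Uh : U *m restrictmx T H = D *m U.
  by rewrite /conjmx 2!(mulmxA U) UV VH -mulmxA.
have := char_poly_stable_dvd Ufree Uh; rewrite ch.
rewrite char_poly_trig ?diag_mx_is_trig // big_split_ord /= big_ord1.
have -> : D (rshift k 0) (rshift k 0) = a.
  by rewrite mxE eqxx mulr1n row_mxEr mxE eqxx mulr1n.
have -> : \prod_(i < k) ('X - (D (lshift 1 i) (lshift 1 i))%:P) =
    \prod_(b <- take k lam) ('X - b%:P).
  have sz : size (take k lam) = k by rewrite size_take size_tuple kr.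
  rewrite (big_nth 0) big_mkord sz; apply: eq_bigr => i _.
  by rewrite [D _ _]mxE eqxx mulr1n row_mxEl mxE nth_take.
rewrite -{2}(cat_take_drop k lam) big_cat /= dvdp_mul2l.
  by rewrite dvdp_XsubCl root_prod_XsubC.
by rewrite monic_neq0 // monic_prod_XsubC.
Qed.

(** * Differential calculus in finitely many coordinates *)

Lemma is_derive_line (R : realType) (V W : normedModType R) (g : V -> W) (y e : V) (s : R) :
  derivable g (s *: e + y) e ->
  is_derive s (1 : R) (fun t => g (t *: e + y)) ('D_e g (s *: e + y)).
Proof.
have E : (fun h : R => h^-1 *: (g ((h *: 1 + s) *: e + y) - g (s *: e + y))) =
    (fun h : R => h^-1 *: (g (h *: e + (s *: e + y)) - g (s *: e + y))).
  by apply/funext => h; rewrite scalerDl [h *: 1]mulr1 addrA.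
by move=> dg; apply: DeriveDef; rewrite /derivable /derive /= E.
Qed.

Lemma mvt_line (R : realType) (V : normedModType R) (g : V -> R) (y e : V) (t : R) :
  (forall s, `|s| <= `|t| -> derivable g (s *: e + y) e) ->
  exists2 s, `|s| <= `|t| & g (t *: e + y) - g y = t * 'D_e g (s *: e + y).
Proof.
move=> dg; pose phi s := g (s *: e + y).
have dphi s : `|s| <= `|t| -> is_derive s (1 : R) phi ('D_e g (s *: e + y)).
  by move=> st; exact: (is_derive_line (dg s st)).
have phi0 : phi 0 = g y by rewrite /phi scale0r add0r.
have cphi (a b : R) : (forall s, s \in `[a, b] -> `|s| <= `|t|) ->
    {within `[a, b], continuous phi}.
  move=> ab; apply: derivable_within_continuous => s sab.
  by have [] := dphi s (ab s sab).
have [t0|t0|t0] := ltgtP t 0.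
- have st s : s \in `[t, 0] -> `|s| <= `|t|.
    by rewrite in_itv /= => /andP[h1 h2]; rewrite !ler0_norm //; lra.
  have [s sin] := MVT t0
    (fun s h => dphi s (st s (subset_itv_oo_cc h))) (cphi _ _ st).
  rewrite phi0 => e0; exists s; first exact/st/subset_itv_oo_cc.
  by rewrite -/(phi t); move: e0; rewrite -/(phi s); lra.
- have st s : s \in `[0, t] -> `|s| <= `|t|.
    by rewrite in_itv /= => /andP[h1 h2]; rewrite !ger0_norm //; lra.
  have [s sin] := MVT t0
    (fun s h => dphi s (st s (subset_itv_oo_cc h))) (cphi _ _ st).
  rewrite phi0 => e0; exists s; first exact/st/subset_itv_oo_cc.
  by rewrite -/(phi t); move: e0; rewrite -/(phi s); lra.
by exists 0; rewrite ?normr0 // t0 scale0r add0r subrr mul0r.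
Qed.

(** Both normed spaces of interest, the row vectors and their pairs, are read
    through such linear coordinates. *)
Definition coordinates (R : realType) (V : normedModType R) n
    (L : 'rV[R]_n -> V) (L' : V -> 'rV[R]_n) : Prop :=
  [/\ linear L, linear L', cancel L' L,
      forall a, `|L a| <= `|a| & forall v, `|L' v| <= `|v|].

Lemma coordinates_rV (R : realType) n :
  coordinates (@id 'rV[R]_n) (@id 'rV[R]_n).
Proof. by split. Qed.

Lemma coordinates_prod (R : realType) m n :
  coordinates (fun a : 'rV[R]_(m + n) => (lsubmx a, rsubmx a))
    (fun p : 'rV[R]_m * 'rV[R]_n => row_mx p.1 p.2).
Proof.
split.
- by move=> a u v; rewrite !linearP.
- by move=> a [u1 u2] [v1 v2] /=; rewrite scale_row_mx add_row_mx.
- by move=> [u1 u2]; rewrite row_mxKl row_mxKr.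
- move=> a; rewrite prod_normE /= ge_max; apply/andP.
  by split; apply: mx_norm_le => // i j; rewrite mxE entry_le.
move=> [u1 u2]; rewrite prod_normE /=; apply: mx_norm_le => [|i j].
  by rewrite le_max normr_ge0.
rewrite mxE le_max; case: splitP => l _; rewrite entry_le ?orbT //.
Qed.

Section Coordinates.
Context {R : realType} {V : normedModType R} {n : nat}.
Context {L : 'rV[R]_n -> V} {L' : V -> 'rV[R]_n}.
Hypothesis LL : coordinates L L'.

Definition basis_vector (j : 'I_n) : V := L (delta_mx 0 j).
Local Notation e := basis_vector.

Lemma coordinates_sum v : v = \sum_(j < n) L' v 0 j *: e j.
Proof.
case: LL => Ll _ K _ _.
pose lM := GRing.isLinear.Build _ _ _ _ _ Ll.
pose l : {linear _ -> _} := HB.pack L lM.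
rewrite -[LHS]K {1}[L' v]row_sum_delta -[L]/(l : _ -> _) linear_sum /=.
by apply: eq_bigr => j _; exact: (linearZZ l).
Qed.

(** The increment is split along the coordinate directions and the mean value
    theorem is applied on each of the n segments. *)
Lemma continuous_partials_differentiable (U : set V) (g : V -> R) :
  open U ->
  (forall x, U x -> forall v, derivable g x v /\ {for x, continuous ('D_v g)}) ->
  forall x, U x -> differentiable g x.
Proof.
move=> Uo dg x Ux; case: (LL) => Ll L'l K nL nL'.
pose l v := \sum_(j < n) L' v 0 j * 'D_(e j) g x.
have ll : linear l.
  move=> a u v; rewrite /l scaler_sumr -big_split /=; apply: eq_bigr => j _.
  by rewrite L'l !mxE mulrDl scalerAl.
have lbound v : `|l v| <= (\sum_(j < n) `|'D_(e j) g x|) * `|v|.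
  apply: le_trans (ler_norm_sum _ _ _) _; rewrite mulr_suml.
  apply: ler_sum => j _; rewrite normrM mulrC ler_wpM2l //.
  by apply: le_trans (nL' v); exact: entry_le.
pose dlM := GRing.isLinear.Build _ _ _ _ _ ll.
pose dl : {linear V -> R} := HB.pack l dlM.
have lc : continuous dl.
  apply/linear_bounded_continuous/linear_boundedP.
  set C := \sum_(j < n) _ in lbound.
  have : \forall r \near +oo, C <= r by apply: nbhs_pinfty_ge; rewrite num_real.
  apply: filterS => r Cr v.
  by apply: le_trans (lbound v) _; apply: ler_wpM2r.
suff main : g \o shift x = cst (g x) + dl +o_ 0 id.
  have E := diff_unique lc main.
  by apply/diff_locallyP; rewrite E; split.
apply/eqaddoP => _/posnumP[eps].
pose ep := eps%:num / n.+1%:R; have ep0 : 0 < ep by rewrite divr_gt0.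
have near_x : \forall y \near x,
    U y /\ forall j, `|'D_(e j) g y - 'D_(e j) g x| <= ep.
  apply: filterI; first by apply: open_nbhs_nbhs; split.
  apply: filter_forall => j.
  have [_ cj] := dg x Ux (e j).
  move/cvgrPdist_le : cj => /(_ ep ep0); apply: filterS => y.
  by rewrite distrC.
have [r /= r0 rx] := (nbhs_ballP _ _).1 near_x.
apply/nbhs_ballP; exists r => //= h; rewrite -ball_normE /= sub0r normrN => hr.
have inball z : `|z| <= `|h| -> ball x r (z + x).
  by move=> zh; rewrite -ball_normE /= opprD addrCA subrr addr0 normrN (le_lt_trans zh).
(* a k keeps the first k coordinates of the increment h *)
pose a k := \row_(j < n) (if (j < k)%N then L' h 0 j else 0).
have step k (kn : (k < n)%N) : `|g (L (a k.+1) + x) - g (L (a k) + x) -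
    L' h 0 (Ordinal kn) * 'D_(e (Ordinal kn)) g x| <= ep * `|h|.
  pose t := L' h 0 (Ordinal kn).
  have ht : `|t| <= `|h| by apply: le_trans (nL' h); exact: entry_le.
  have La s : s *: e (Ordinal kn) + L (a k) = L (s *: delta_mx 0 (Ordinal kn) + a k).
    by rewrite Ll.
  have Lb s : `|s| <= `|t| -> `|s *: e (Ordinal kn) + L (a k)| <= `|h|.
    move=> st; rewrite La; apply: le_trans (nL _) _.
    apply: mx_norm_le => // i j; rewrite !mxE ord1 eqxx /=.
    have [->|jk] := eqVneq j (Ordinal kn).
      by rewrite ltnn addr0 mulr1 (le_trans st).
    rewrite mulr0 add0r; case: ifP => _; last by rewrite normr0.
    by apply: le_trans (nL' h); exact: entry_le.
  have ak : a k.+1 = t *: delta_mx 0 (Ordinal kn) + a k.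
    apply/rowP => j; rewrite !mxE eqxx /= ltnS leq_eqVlt -val_eqE /=.
    have [jk|jk] := eqVneq (j : nat) k; last by rewrite mulr0 add0r.
    by rewrite jk ltnn addr0 mulr1; congr (L' h 0 _); exact: val_inj.
  rewrite ak -La -(addrA _ (L (a k))).
  have [s st ->] : exists2 s, `|s| <= `|t| &
      g (t *: e (Ordinal kn) + (L (a k) + x)) - g (L (a k) + x) =
      t * 'D_(e (Ordinal kn)) g (s *: e (Ordinal kn) + (L (a k) + x)).
    apply: mvt_line => s st; rewrite addrA.
    by have [/dg /(_ (e (Ordinal kn)))[]] := rx _ (inball _ (Lb s st)).
  rewrite -/t -mulrBr normrM mulrC; apply: ler_pM => //.
  by rewrite addrA; have [_] := rx _ (inball _ (Lb s st)).
have a0 : L (a 0) = 0.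
  have -> : a 0 = 0 by apply/rowP => j; rewrite !mxE.
  by have := Ll (-1) 0 0; rewrite scaler0 addr0 scaleN1r addNr.
have an : L (a n) = h.
  by rewrite -[RHS]K; congr L; apply/rowP => j; rewrite !mxE ltn_ord.
have -> : (g \o shift x - (cst (g x) + dl)) h = \sum_(j < n) (g (L (a j.+1) + x) -
    g (L (a j) + x) - L' h 0 j * 'D_(e j) g x).
  rewrite -[LHS]/(g (h + x) - (g x + l h)).
  rewrite big_split /= sumrN -/(l h) opprD addrA; congr (_ - _).
  rewrite -(big_mkord xpredT (fun j => g (L (a j.+1) + x) - g (L (a j) + x))).
  by rewrite telescope_sumr // an a0 add0r.
apply: le_trans (ler_norm_sum _ _ _) _.
apply: (@le_trans _ _ (\sum_(j < n) ep * `|h|)).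
  apply: ler_sum => j _; have := step j (ltn_ord j).
  by rewrite (_ : Ordinal _ = j) //; exact: val_inj.
rewrite sumr_const card_ord -mulr_natl mulrA; apply: ler_wpM2r => //.
rewrite /ep mulrCA ger_pMr // ler_pdivrMr ?mul1r ?ler_nat //.
Qed.
End Coordinates.

Section ClassC.
Context {R : realType} {V W : normedModType R}.

Lemma continuous_near_eq (T : topologicalType) (f g : V -> T) (x : V) :
  (\forall y \near x, f y = g y) ->
  {for x, continuous f} -> {for x, continuous g}.
Proof.
move=> fg cf; rewrite /prop_for /continuous_at -(nbhs_singleton fg).
by apply: cvg_trans cf; apply: near_eq_cvg.
Qed.

Lemma near_open_eq (U : set V) (T : Type) (f g : V -> T) (x : V) :
  open U -> U x -> (forall y, U y -> f y = g y) -> \forall y \near x, f y = g y.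
Proof. by move=> Uo Ux fg; apply: filterS fg _; apply: open_nbhs_nbhs. Qed.

Lemma C_class_eq n (U : set V) (f g : V -> W) :
  open U -> (forall x, U x -> f x = g x) -> C_class n U f -> C_class n U g.
Proof.
move=> Uo; elim: n f g => [|n IH] f g fg [cf df]; split.
- move=> x Ux; apply: continuous_near_eq (cf x Ux); exact: (near_open_eq Uo).
- by [].
- move=> x Ux; apply: continuous_near_eq (cf x Ux); exact: (near_open_eq Uo).
move=> v; have [dv cv] := df v; split.
  move=> x Ux; apply: near_eq_derivable (dv x Ux); exact: (near_open_eq Uo).
apply: IH cv => x Ux; apply: near_eq_derive; exact: (near_open_eq Uo).
Qed.

End ClassC.

Lemma C_class_coord (R : realType) (V : normedModType R) n p q (U : set V)
    (M : V -> 'M[R]_(p, q)) i j :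
  open U -> C_class n U M -> C_class n U (fun x => M x i j).
Proof.
move=> Uo; elim: n M => [|n IH] M [cM dM].
all: have cM_ij : forall x, U x -> {for x, continuous (fun x => M x i j)} by
  move=> x Ux;
  (apply: (@continuous_comp _ _ _ M (fun N : 'M[R]_(p, q) => N i j));
    [exact: cM|exact: coord_continuous]).
all: split.
- by move=> x Ux; exact: cM_ij.
- by [].
- by move=> x Ux; exact: cM_ij.
move=> v; have [dv cv] := dM v; split.
  by move=> x Ux; exact: ((derivable_mxP _ _ _).1 (dv x Ux)).
apply: (@C_class_eq _ _ _ n U (fun x => ('D_v M x) i j)) => //.
  by move=> x Ux; rewrite (derive_mx (dv x Ux)) mxE.
exact: IH.
Qed.

Section ClassC1.
Context {R : realType} {V W : normedModType R}.

(** In this form of class C^1, which continuous directional derivatives imply,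
    the total differential exists, as the chain rule requires. *)
Definition C1_on (U : set V) (g : V -> W) : Prop :=
  forall x, U x -> differentiable g x /\ forall v, {for x, continuous ('D_v g)}.

Lemma C1_on_continuous U g x : C1_on U g -> U x -> {for x, continuous g}.
Proof. by move=> cg /cg[dg _]; exact: differentiable_continuous. Qed.

Lemma C1_on_sub (U U' : set V) g : U' `<=` U -> C1_on U g -> C1_on U' g.
Proof. by move=> UU cg x /UU; exact: cg. Qed.

Lemma C1_on_eq (U : set V) (f g : V -> W) :
  open U -> (forall x, U x -> f x = g x) -> C1_on U f -> C1_on U g.
Proof.
move=> Uo fg cf x Ux; have [df cdf] := cf x Ux; split.
  have [dfc /eqaddoP fE] := (diff_locallyP _ _).1 df.
  have fx : \forall y \near x, f y = g y by exact: (near_open_eq Uo).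
  have main : g \o shift x = cst (g x) + 'd f x +o_ 0 id.
    apply/eqaddoP => eps /fE; move: fx.
    rewrite (near_shift 0) subr0; apply: filterS2 => h /= fgh.
    rewrite -[(f \o _ - _) h]/(f (h + x) - (f x + 'd f x h)).
    by rewrite -[(g \o _ - _) h]/(g (h + x) - (g x + 'd f x h)) fgh (fg x Ux).
  have E := diff_unique dfc main.
  by apply/diff_locallyP; rewrite E; split.
move=> v; apply: continuous_near_eq (cdf v).
apply: (near_open_eq Uo) => // y Uy; apply: near_eq_derive.
exact: (near_open_eq Uo).
Qed.

Lemma C1_on_cst U (a : W) : C1_on U (cst a).
Proof.
move=> x Ux; split; first exact: differentiable_cst.
move=> v; have -> : 'D_v (cst a) = cst 0.
  by apply/funext => y; exact: derive_cst.
exact: cst_continuous.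
Qed.

Lemma C1_onD (U : set V) (f g : V -> W) : open U ->
  C1_on U f -> C1_on U g -> C1_on U (fun x => f x + g x).
Proof.
move=> Uo cf cg x Ux; have [df cdf] := cf x Ux; have [dg cdg] := cg x Ux.
split; first exact: differentiableD.
move=> v; have : {for x, continuous (fun y => 'D_v f y + 'D_v g y)}.
  by apply: continuousD.
apply: continuous_near_eq; apply: (near_open_eq Uo) => // y Uy.
by rewrite deriveD //; apply: diff_derivable; [have [] := cf y Uy|have [] := cg y Uy].
Qed.

End ClassC1.

Lemma C1_on_C_class (R : realType) (V : normedModType R) n
    (L : 'rV[R]_n -> V) (L' : V -> 'rV[R]_n) (U : set V) (g : V -> R) :
  coordinates L L' -> open U -> C_class 1 U g -> C1_on U g.
Proof.
move=> LL Uo [cg dg].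
have H x : U x -> forall v, derivable g x v /\ {for x, continuous ('D_v g)}.
  by move=> Ux v; have [dv [cv _]] := dg v; split; [exact: dv|exact: cv].
move=> x Ux; split; last by move=> v; have [] := H x Ux v.
exact: (continuous_partials_differentiable LL Uo H).
Qed.

Lemma is_derive_translate (R : realType) (V W : normedModType R) (g : V -> W)
    (c y v : V) (l : W) :
  is_derive (c + y) v g l -> is_derive y v (fun z => g (c + z)) l.
Proof.
have E : (fun h : R => h^-1 *: (g (c + (h *: v + y)) - g (c + y))) =
    (fun h : R => h^-1 *: (g (h *: v + (c + y)) - g (c + y))).
  by apply/funext => h; rewrite addrCA.
by move=> [dg dl]; apply: DeriveDef; rewrite /derivable /derive /= E.
Qed.

Lemma dist_common_approx (R : realType) (A B A' B' eps : R) :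
  A' = B' -> `|A - A'| <= eps / 2 -> `|B - B'| <= eps / 2 -> `|A - B| <= eps.
Proof.
by move=> ->; rewrite !ler_norml => /andP[? ?] /andP[? ?]; apply/andP; split; lra.
Qed.

(** Both mixed derivatives are limits of the same second difference quotient,
    which two applications of the mean value theorem express in either order
    of differentiation. *)
Lemma schwarz (R : realType) (V : normedModType R) (U : set V) (g : V -> R)
    (x u v : V) :
  open U -> U x -> C_class 2 U g -> 'D_u ('D_v g) x = 'D_v ('D_u g) x.
Proof.
move=> Uo Ux [_ dg].
have d1 w y : U y -> derivable g y w by move=> Uy; have [d _] := dg w; exact: d.
have d2 w w' y : U y -> derivable ('D_w g) y w'.
  by move=> Uy; have [_ [_ d]] := dg w; have [d' _] := d w'; exact: d'.
have c2 w w' : {for x, continuous ('D_w' ('D_w g))}.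
  by have [_ [_ d]] := dg w; have [_ [c _]] := d w'; exact: c.
have [r r0 rU] := (nbhs_ballP _ _).1 (open_nbhs_nbhs (conj Uo Ux)).
have main (a b : V) (h : R) : h != 0 -> `|h| * (`|a| + `|b|) < r ->
    exists2 y, `|y - x| <= `|h| * (`|a| + `|b|) &
      g (h *: a + (h *: b + x)) - g (h *: b + x) - (g (h *: a + x) - g x) =
      h * (h * 'D_b ('D_a g) y).
  move=> h0 hr; pose psi y := g (h *: b + y) - g y.
  have bl s t : `|s| <= `|h| -> `|t| <= `|h| ->
      `|t *: b + (s *: a + x) - x| <= `|h| * (`|a| + `|b|).
    move=> sh th; rewrite addrA addrK; apply: le_trans (ler_normD _ _) _.
    by rewrite mulrDr addrC !normrZ lerD // ler_wpM2r.
  have inU s t : `|s| <= `|h| -> `|t| <= `|h| -> U (t *: b + (s *: a + x)).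
    move=> sh th; apply: rU; rewrite -ball_normE /= distrC.
    exact: le_lt_trans (bl s t sh th) hr.
  have inU0 s : `|s| <= `|h| -> U (s *: a + x).
    by move=> sh; rewrite -[X in U X]add0r -(scale0r b); apply: inU => //; rewrite normr0.
  have dpsi s : `|s| <= `|h| -> is_derive (s *: a + x) a psi
      ('D_a g (h *: b + (s *: a + x)) - 'D_a g (s *: a + x)).
    move=> sh; have D1 := derivableP (d1 a _ (inU s h sh (lexx _))).
    have D2 := derivableP (d1 a _ (inU0 s sh)).
    apply: is_deriveB D2.
    exact: is_derive_translate D1.
  have [s sh Es] : exists2 s, `|s| <= `|h| &
      psi (h *: a + x) - psi x = h * 'D_a psi (s *: a + x).
    by apply: (@mvt_line _ _ psi _ a h) => s sh; have [] := dpsi s sh.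
  have [t th Et] : exists2 t, `|t| <= `|h| &
      'D_a g (h *: b + (s *: a + x)) - 'D_a g (s *: a + x) =
      h * 'D_b ('D_a g) (t *: b + (s *: a + x)).
    by apply: (@mvt_line _ _ ('D_a g) _ b h) => t th; apply: d2; exact: inU.
  exists (t *: b + (s *: a + x)); first exact: bl.
  rewrite -Et; have [_ <-] := dpsi s sh; rewrite -Es /psi (addrCA (h *: a)).
  by ring.
suff main' : `|'D_u ('D_v g) x - 'D_v ('D_u g) x| <= 0.
  by apply/eqP; rewrite -subr_eq0 -normr_le0.
apply/ler_addgt0Pr => eps eps0.
have e2 : 0 < eps / 2 by rewrite divr_gt0.
have /cvgrPdist_le/(_ _ e2) cuv := c2 u v.
have /cvgrPdist_le/(_ _ e2) cvu := c2 v u.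
have [r' /= r'0 H] := (nbhs_ballP _ _).1 (filterI cuv cvu).
pose h : R := Num.min r r' / (`|u| + `|v| + 1) / 2.
have m0 : 0 < Num.min r r' by rewrite lt_min r0 r'0.
have D0 : 0 < `|u| + `|v| + 1 by rewrite ltr_wpDl // addr_ge0.
have h0 : 0 < h by rewrite !divr_gt0.
have hb : `|h| * (`|u| + `|v|) < Num.min r r'.
  have hD : h * (`|u| + `|v| + 1) = Num.min r r' / 2.
    by rewrite /h mulrAC divfK // gt_eqF.
  have : h * (`|u| + `|v|) <= h * (`|u| + `|v| + 1).
    by apply: ler_wpM2l; [exact: ltW|rewrite lerDl].
  by rewrite hD gtr0_norm // => /le_lt_trans; apply; rewrite ltr_pdivrMr // ltr_pMr // ltr1n.
move: (hb); rewrite lt_min => /andP[hbr hbr'].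
have hn0 : h != 0 by rewrite gt_eqF.
have hbr2 : `|h| * (`|v| + `|u|) < r by rewrite (addrC `|v|).
have [y yx Ey] := main v u h hn0 hbr2.
have [z zx Ez] := main u v h hn0 hbr.
(* one second difference, evaluated in the two orders *)
have yz : 'D_u ('D_v g) y = 'D_v ('D_u g) z.
  have E : h * (h * 'D_u ('D_v g) y) = h * (h * 'D_v ('D_u g) z).
    by rewrite -[LHS]Ey -[RHS]Ez (addrCA (h *: v) (h *: u) x); ring.
  exact: (mulfI hn0 (mulfI hn0 E)).
have inb w : `|w - x| <= `|h| * (`|u| + `|v|) -> ball x r' w.
  by move=> wx; rewrite -ball_normE /= distrC; exact: le_lt_trans hbr'.
rewrite (addrC `|v|) in yx; have [_ Hy] := H y (inb y yx).
have [Hz _] := H z (inb z zx).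
rewrite add0r; exact: dist_common_approx yz Hy Hz.
Qed.

Section RealC1.
Context {R : realType} {V : normedModType R}.
Implicit Types (U : set V) (f g : V -> R).

Lemma C1_onM U f g : open U ->
  C1_on U f -> C1_on U g -> C1_on U (fun x => f x * g x).
Proof.
move=> Uo cf cg x Ux; have [df cdf] := cf x Ux; have [dg cdg] := cg x Ux.
split; first exact: differentiableM.
move=> v.
have : {for x, continuous (fun y => f y * 'D_v g y + g y * 'D_v f y)}.
  apply: continuousD; apply: continuousM => //; exact: differentiable_continuous.
apply: continuous_near_eq; apply: (near_open_eq Uo) => // y Uy.
rewrite -[RHS]/('D_v (f * g) y) deriveM //.
  by apply: diff_derivable; have [] := cf y Uy.
by apply: diff_derivable; have [] := cg y Uy.
Qed.

Lemma C1_onV U f : open U -> (forall x, U x -> f x != 0) ->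
  C1_on U f -> C1_on U (fun x => (f x)^-1).
Proof.
move=> Uo f0 cf x Ux; have [df cdf] := cf x Ux.
split; first by apply: differentiableV => //; exact: f0.
move=> v; have cfx : {for x, continuous (fun y => (f y)^-1)}.
  by apply: continuousV; [exact: f0|exact: differentiable_continuous].
have : {for x, continuous (fun y => - ((f y)^-1 * (f y)^-1 * 'D_v f y))}.
  by apply: continuousN; apply: continuousM => //; apply: continuousM.
apply: continuous_near_eq; apply: (near_open_eq Uo) => // y Uy.
rewrite -[RHS]/('D_v (fun z => (f z)^-1) y) deriveV ?f0 //.
  by rewrite scaleNr -exprVn expr2.
by apply: diff_derivable; have [] := cf y Uy.
Qed.

Lemma C1_on_sum U I (r : seq I) (P : pred I) (F : I -> V -> R) : open U ->
  (forall i, P i -> C1_on U (F i)) ->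
  C1_on U (fun x => \sum_(i <- r | P i) F i x).
Proof.
move=> Uo cF; elim: r => [|i r IH].
  have -> : (fun x => \sum_(i <- [::] | P i) F i x) = cst 0.
    by apply/funext => x; rewrite big_nil.
  exact: C1_on_cst.
have [Pi|Pi] := boolP (P i); last first.
  have -> : (fun x => \sum_(j <- i :: r | P j) F j x) =
      (fun x => \sum_(j <- r | P j) F j x).
    by apply/funext => x; rewrite big_cons (negbTE Pi).
  exact: IH.
have -> : (fun x => \sum_(j <- i :: r | P j) F j x) =
    (fun x => F i x + \sum_(j <- r | P j) F j x).
  by apply/funext => x; rewrite big_cons Pi.
exact: (C1_onD Uo (cF i Pi) IH).
Qed.

Lemma C1_on_prod U I (r : seq I) (P : pred I) (F : I -> V -> R) : open U ->
  (forall i, P i -> C1_on U (F i)) ->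
  C1_on U (fun x => \prod_(i <- r | P i) F i x).
Proof.
move=> Uo cF; elim: r => [|i r IH].
  have -> : (fun x => \prod_(i <- [::] | P i) F i x) = cst 1.
    by apply/funext => x; rewrite big_nil.
  exact: C1_on_cst.
have [Pi|Pi] := boolP (P i); last first.
  have -> : (fun x => \prod_(j <- i :: r | P j) F j x) =
      (fun x => \prod_(j <- r | P j) F j x).
    by apply/funext => x; rewrite big_cons (negbTE Pi).
  exact: IH.
have -> : (fun x => \prod_(j <- i :: r | P j) F j x) =
    (fun x => F i x * \prod_(j <- r | P j) F j x).
  by apply/funext => x; rewrite big_cons Pi.
exact: (C1_onM Uo (cF i Pi) IH).
Qed.

End RealC1.

Section MatrixC1.
Context {R : realType} {V : normedModType R}.
Implicit Types U : set V.

Lemma continuous_mx (T : topologicalType) m n (M : T -> 'M[R]_(m, n)) x :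
  (forall i j, {for x, continuous (fun y => M y i j)}) -> {for x, continuous M}.
Proof.
move=> cM; apply/cvgrPdist_le => e e0.
have : \forall y \near x, forall i j, `|M x i j - M y i j| <= e.
  apply: filter_forall => i; apply: filter_forall => j.
  by have /cvgrPdist_le/(_ _ e0) := cM i j.
apply: filterS => y Hy; apply: mx_norm_le => [|i j]; first exact: ltW.
by rewrite !mxE.
Qed.

Lemma differentiable_mx m n (M : V -> 'M[R]_(m, n)) x :
  (forall i j, differentiable (fun y => M y i j) x) -> differentiable M x.
Proof.
move=> dM; have -> : M = \sum_(i < m) \sum_(j < n)
    (fun y => M y i j *: (delta_mx i j : 'M[R]_(m, n))).
  apply/funext => y; rewrite {1}[M y]matrix_sum_delta fct_sumE.
  by apply: eq_bigr => i _; rewrite fct_sumE.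
apply: differentiable_sum => i; apply: differentiable_sum => j.
exact: differentiableZl.
Qed.

Lemma C1_on_mx U m n (M : V -> 'M[R]_(m, n)) : open U ->
  (forall i j, C1_on U (fun x => M x i j)) -> C1_on U M.
Proof.
move=> Uo cM; have dM x : U x -> differentiable M x.
  by move=> Ux; apply: differentiable_mx => i j; have [] := cM i j x Ux.
move=> x Ux; split; first exact: dM.
move=> v; apply: continuous_mx => i j.
have [_ /(_ v)] := cM i j x Ux.
apply: continuous_near_eq; apply: (near_open_eq Uo) => // y Uy.
by rewrite derive_mx ?mxE //; apply: diff_derivable; exact: dM.
Qed.

Lemma C1_on_coord U m n (M : V -> 'M[R]_(m, n)) i j : open U ->
  C1_on U M -> C1_on U (fun x => M x i j).
Proof.
move=> Uo cM x Ux; have [dM cdM] := cM x Ux; split.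
  apply: (@differentiable_comp _ _ _ _ M (fun N : 'M[R]_(m, n) => N i j)) => //.
  exact: differentiable_coord.
move=> v; have : {for x, continuous (fun y => 'D_v M y i j)}.
  apply: (@continuous_comp _ _ _ ('D_v M) (fun N : 'M[R]_(m, n) => N i j)).
    exact: cdM.
  exact: coord_continuous.
apply: continuous_near_eq; apply: (near_open_eq Uo) => // y Uy.
by rewrite derive_mx ?mxE //; apply: diff_derivable; have [] := cM y Uy.
Qed.

Lemma C1_on_mulmx U m n p (M : V -> 'M[R]_(m, n)) (N : V -> 'M[R]_(n, p)) :
  open U -> C1_on U M -> C1_on U N -> C1_on U (fun x => M x *m N x).
Proof.
move=> Uo cM cN; apply: (C1_on_mx Uo) => i j.
have -> : (fun x => (M x *m N x) i j) = (fun x => \sum_(k < n) M x i k * N x k j).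
  by apply/funext => x; rewrite mxE.
refine (@C1_on_sum _ _ U _ _ xpredT (fun k x => M x i k * N x k j) Uo _) => k _.
exact: (C1_onM Uo (C1_on_coord _ _ Uo cM) (C1_on_coord _ _ Uo cN)).
Qed.

Lemma C1_on_trmx U m n (M : V -> 'M[R]_(m, n)) :
  open U -> C1_on U M -> C1_on U (fun x => (M x)^T).
Proof.
move=> Uo cM; apply: (C1_on_mx Uo) => i j.
have -> : (fun x => (M x)^T i j) = (fun x => M x j i).
  by apply/funext => x; rewrite mxE.
exact: (C1_on_coord _ _ Uo cM).
Qed.

Lemma C1_onZ U m n (a : V -> R) (M : V -> 'M[R]_(m, n)) :
  open U -> C1_on U a -> C1_on U M -> C1_on U (fun x => a x *: M x).
Proof.
move=> Uo ca cM; apply: (C1_on_mx Uo) => i j.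
have -> : (fun x => (a x *: M x) i j) = (fun x => a x * M x i j).
  by apply/funext => x; rewrite mxE.
exact: (C1_onM Uo ca (C1_on_coord _ _ Uo cM)).
Qed.

Lemma C1_on_det U n (M : V -> 'M[R]_n) :
  open U -> C1_on U M -> C1_on U (fun x => \det (M x)).
Proof.
move=> Uo cM.
refine (@C1_on_sum _ _ U _ _ xpredT
  (fun (s : {perm 'I_n}) x => (-1) ^+ s * \prod_i M x i (s i)) Uo _) => s _.
apply: (C1_onM Uo (C1_on_cst _)).
refine (@C1_on_prod _ _ U _ _ xpredT (fun i x => M x i (s i)) Uo _) => i _.
exact: (C1_on_coord _ _ Uo cM).
Qed.

Lemma C1_on_invmx U n (M : V -> 'M[R]_n) : open U ->
  (forall x, U x -> M x \in unitmx) -> C1_on U M -> C1_on U (fun x => invmx (M x)).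
Proof.
move=> Uo Mu cM.
have E x : U x -> (\det (M x))^-1 *: \adj (M x) = invmx (M x).
  by move=> Ux; rewrite /invmx Mu.
have det0 x : U x -> \det (M x) != 0 by move=> /Mu; rewrite unitmxE unitfE.
apply: (C1_on_eq Uo E); apply: (C1_onZ Uo (C1_onV Uo det0 (C1_on_det Uo cM))).
apply: (C1_on_mx Uo) => i j.
have -> : (fun x => \adj (M x) i j) =
    (fun x => (-1) ^+ (j + i) * \det (row' j (col' i (M x)))).
  by apply/funext => x; rewrite mxE.
apply: (C1_onM Uo (C1_on_cst _)); apply: (C1_on_det Uo).
apply: (C1_on_mx Uo) => k l.
have -> : (fun x => row' j (col' i (M x)) k l) = (fun x => M x (lift j k) (lift i l)).
  by apply/funext => x; rewrite !mxE.
exact: (C1_on_coord _ _ Uo cM).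
Qed.

Lemma derive_mulmx m n p (M : V -> 'M[R]_(m, n)) (N : V -> 'M[R]_(n, p)) x v :
  differentiable M x -> differentiable N x ->
  'D_v (fun y => M y *m N y) x = 'D_v M x *m N x + M x *m 'D_v N x.
Proof.
move=> dM dN.
have dMc i j : differentiable (fun y => M y i j) x.
  apply: (@differentiable_comp _ _ _ _ M (fun N : 'M[R]_(m, n) => N i j)) => //.
  exact: differentiable_coord.
have dNc i j : differentiable (fun y => N y i j) x.
  apply: (@differentiable_comp _ _ _ _ N (fun N : 'M[R]_(n, p) => N i j)) => //.
  exact: differentiable_coord.
have E i j : (fun y => (M y *m N y) i j) =
    \sum_(k < n) ((fun y => M y i k) * (fun y => N y k j)).
  by apply/funext => y; rewrite mxE fct_sumE.
have dMN i j : derivable (fun y => (M y *m N y) i j) x v.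
  rewrite E; apply: derivable_sum => k.
  by apply: diff_derivable; exact: differentiableM.
have /derive_mx -> : derivable (fun y => M y *m N y) x v by apply/derivable_mxP.
apply/matrixP => i j; rewrite !mxE E derive_sum; last first.
  by move=> k; apply: diff_derivable; exact: differentiableM.
rewrite -big_split /=; apply: eq_bigr => k _.
rewrite deriveM; [|exact: diff_derivable|exact: diff_derivable].
rewrite (derive_mx (diff_derivable dM)) (derive_mx (diff_derivable dN)) !mxE.
by rewrite addrC; congr (_ + _); exact: mulrC.
Qed.

End MatrixC1.

Section ChainRule.
Context {R : realType} {V V' W : normedModType R}.

Lemma derive_comp (f : V -> V') (g : V' -> W) x v :
  differentiable f x -> differentiable g (f x) ->
  'D_v (g \o f) x = 'D_('D_v f x) g (f x).
Proof.
move=> df dg; rewrite !deriveE //; last exact: differentiable_comp.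
by rewrite diff_comp.
Qed.

Lemma derive_add (g : V -> W) x u v : differentiable g x ->
  'D_(u + v) g x = 'D_u g x + 'D_v g x.
Proof. by move=> dg; rewrite !deriveE // linearD. Qed.

Lemma derive_scale (g : V -> W) x a v : differentiable g x ->
  'D_(a *: v) g x = a *: 'D_v g x.
Proof. by move=> dg; rewrite !deriveE // linearZ. Qed.

End ChainRule.

Lemma derive_coordinates (R : realType) (V W : normedModType R) n
    (L : 'rV[R]_n -> V) L' (g : V -> W) x v :
  coordinates L L' -> differentiable g x ->
  'D_v g x = \sum_(j < n) L' v 0 j *: 'D_(basis_vector (L := L) j) g x.
Proof.
move=> LL dg; rewrite {1}(coordinates_sum LL v) deriveE // linear_sum.
by apply: eq_bigr => j _; rewrite linearZ deriveE.
Qed.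

Lemma coordinates_continuous (R : realType) (V : normedModType R) n
    (L : 'rV[R]_n -> V) L' j :
  coordinates L L' -> continuous (fun v => L' v 0 j).
Proof.
move=> [_ L'l _ _ nL'] v; apply/cvgrPdist_le => e e0.
apply/nbhs_ballP; exists e => //= w; rewrite -ball_normE /= => vw.
have -> : L' v 0 j - L' w 0 j = L' (v - w) 0 j.
  by rewrite addrC -scaleN1r (addrC v) -[- w]scaleN1r L'l !mxE.
by apply: le_trans (entry_le _ _ _) _; apply: le_trans (nL' _) _; exact: ltW.
Qed.

Lemma C1_on_comp (R : realType) (V V' W : normedModType R) n
    (L : 'rV[R]_n -> V') L' (U : set V) (U' : set V') (f : V -> V') (g : V' -> W) :
  coordinates L L' -> open U -> (forall x, U x -> U' (f x)) ->
  C1_on U f -> C1_on U' g -> C1_on U (g \o f).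
Proof.
move=> LL Uo fU cf cg x Ux.
have [df cdf] := cf x Ux; have [dg cdg] := cg _ (fU x Ux).
split; first exact: differentiable_comp.
move=> v; have : {for x, continuous (fun y => \sum_(j < n)
    L' ('D_v f y) 0 j *: 'D_(basis_vector (L := L) j) g (f y))}.
  apply: (cvg_big (op := +%R)) => [|j _]; first exact: add_continuous.
  apply: (@continuousZ _ _ _ (fun y => L' ('D_v f y) 0 j)
    (fun y => 'D_(basis_vector (L := L) j) g (f y))).
    apply: (@continuous_comp _ _ _ ('D_v f) (fun w => L' w 0 j)); first exact: cdf.
    exact: (coordinates_continuous LL).
  apply: (@continuous_comp _ _ _ f ('D_(basis_vector (L := L) j) g)).
    exact: differentiable_continuous.
  exact: cdg.
apply: continuous_near_eq; apply: (near_open_eq Uo) => // y Uy.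
have [dfy _] := cf y Uy; have [dgy _] := cg _ (fU y Uy).
by rewrite derive_comp // (derive_coordinates _ LL).
Qed.

Lemma C1_on_C_class_mx (R : realType) (V : normedModType R) n
    (L : 'rV[R]_n -> V) (L' : V -> 'rV[R]_n) (U : set V) p q (G : V -> 'M[R]_(p, q)) :
  coordinates L L' -> open U -> C_class 1 U G -> C1_on U G.
Proof.
move=> LL Uo cG; apply: (C1_on_mx Uo) => i j.
exact: (C1_on_C_class LL Uo (C_class_coord i j Uo cG)).
Qed.

Section LocalBounds.
Context {R : realType} {V : normedModType R} {n : nat}.
Context {L : 'rV[R]_n -> V} {L' : V -> 'rV[R]_n}.
Hypothesis LL : coordinates L L'.
Variables (U : set V) (x0 : V).
Hypotheses (Uo : open U) (Ux : U x0).

(** Continuity of the finitely many partial derivatives is continuity in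
    operator norm. *)
Lemma near_derive_dist (W : normedModType R) (g : V -> W) (eps : R) :
  C1_on U g -> 0 < eps ->
  \forall p \near x0, forall v, `|'D_v g p - 'D_v g x0| <= eps * `|v|.
Proof.
move=> cg eps0; pose e j := basis_vector (L := L) j.
have ep0 : 0 < eps / n.+1%:R by rewrite divr_gt0.
have : \forall p \near x0, U p /\
    forall j, `|'D_(e j) g p - 'D_(e j) g x0| <= eps / n.+1%:R.
  apply: filterI; first exact: open_nbhs_nbhs.
  apply: filter_forall => j.
  have [_ /(_ (e j)) cj] := cg x0 Ux.
  move/cvgrPdist_le : cj => /(_ _ ep0); apply: filterS => p.
  by rewrite distrC.
have [dg0 _] := cg x0 Ux.
apply: filterS => p [Up Hp] v; have [dgp _] := cg p Up.
rewrite !(derive_coordinates _ LL) // -sumrB.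
apply: le_trans (ler_norm_sum _ _ _) _.
apply: (@le_trans _ _ (\sum_(j < n) eps / n.+1%:R * `|v|)).
  apply: ler_sum => j _; rewrite -scalerBr normrZ mulrC; apply: ler_pM => //.
  by case: LL => _ _ _ _ nL'; apply: le_trans (nL' v); exact: entry_le.
rewrite sumr_const card_ord -[leLHS]mulr_natl mulrA; apply: ler_wpM2r => //.
by rewrite mulrCA ger_pMr // ler_pdivrMr // mul1r ler_nat.
Qed.

Lemma near_derive_bound (W : normedModType R) (g : V -> W) : C1_on U g ->
  exists2 K : R, 0 <= K & \forall p \near x0, forall v, `|'D_v g p| <= K * `|v|.
Proof.
move=> cg; have [dg _] := cg x0 Ux.
have [K K0 KP] := linear_lipschitz (diff_continuous dg).
exists (K + 1); first by rewrite addr_ge0 // ltW.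
apply: filterS (near_derive_dist cg ltr01) => p Hp v.
rewrite -['D_v g p](subrK ('D_v g x0)); apply: le_trans (ler_normD _ _) _.
rewrite mulrDl addrC; apply: lerD; last exact: Hp.
by rewrite deriveE //; exact: KP.
Qed.

Lemma local_lipschitz (g : V -> R) : C1_on U g ->
  exists2 K : R, 0 <= K & exists2 r, 0 < r &
    forall p q, ball x0 r p -> ball x0 r q -> `|g p - g q| <= K * `|p - q|.
Proof.
move=> cg; have [K K0 HK] := near_derive_bound cg; exists K => //.
have [r /= r0 rU] := (nbhs_ballP _ _).1 (filterI (open_nbhs_nbhs (conj Uo Ux)) HK).
exists r => // p q pr qr.
have line s : 0 <= s -> s <= 1 -> ball x0 r (s *: (p - q) + q).
  move=> s0 s1; rewrite -ball_normE /=.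
  have -> : x0 - (s *: (p - q) + q) = s *: (x0 - p) + (1 - s) *: (x0 - q).
    have pq : p - q = (x0 - q) - (x0 - p) by rewrite opprB [RHS]addrC addrA subrK.
    rewrite pq opprD addrCA scalerBr opprB [in RHS]scalerBl scale1r.
    by rewrite -addrA [- _ + _]addrC.
  apply: le_lt_trans (ler_normD _ _) _; rewrite !normrZ (ger0_norm s0).
  rewrite ger0_norm ?subr_ge0 //.
  move: pr qr; rewrite -!ball_normE /=; set a := `|x0 - p|; set b := `|x0 - q|.
  move=> ar br; have [s_0|s_0] := eqVneq s 0; first by rewrite s_0 mul0r add0r subr0 mul1r.
  have sp : 0 < s by rewrite lt_neqAle eq_sym s_0.
  have h1 : s * a < s * r by rewrite ltr_pM2l.
  have h2 : (1 - s) * b <= (1 - s) * r by rewrite ler_wpM2l ?subr_ge0 // ltW.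
  lra.
pose phi s := g (s *: (p - q) + q).
have dphi (s : R) : s \in `[0, 1] -> is_derive s (1 : R) phi ('D_(p - q) g (s *: (p - q) + q)).
  rewrite in_itv /= => /andP[s0 s1].
  have [/cg[dg _] _] := rU _ (line s s0 s1).
  by apply: is_derive_line; exact: diff_derivable.
have cphi : {within `[0, 1], continuous phi}.
  by apply: derivable_within_continuous => s /dphi[].
have [s sin] := MVT ltr01 (fun s h => dphi s (subset_itv_oo_cc h)) cphi.
rewrite /phi scale1r subrK scale0r add0r subr0 mulr1 => ->.
have := subset_itv_oo_cc sin; rewrite in_itv /= => /andP[s0 s1].
by have [_] := rU _ (line s s0 s1); exact.
Qed.

(** This is where two derivatives of the retraction are used: the derivative at
    a displaced point must be compared with the one at the zero section up to
    an error proportional to the displacement, hence to the step size. *)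
Lemma derive_lipschitz d (G : V -> 'rV[R]_d) : C_class 2 U G ->
  exists2 K : R, 0 <= K & exists2 r, 0 < r & forall p q v,
    ball x0 r p -> ball x0 r q -> `|'D_v G p - 'D_v G q| <= K * `|v| * `|p - q|.
Proof.
move=> cG; pose e j := basis_vector (L := L) j.
have cGi i : C_class 2 U (fun p => G p 0 i) by exact: C_class_coord.
have cG1 : C1_on U G.
  apply: (C1_on_C_class_mx LL Uo); have [cG0 dG] := cG; split; first exact: cG0.
  by move=> v; have [d1 [d2 _]] := dG v; split; [exact: d1|split].
have cGij i j : C1_on U ('D_(e j) (fun p => G p 0 i)).
  by apply: (C1_on_C_class LL Uo); have [_ /(_ (e j))[]] := cGi i.
have /choice[K HK] : forall ij : 'I_d * 'I_n, exists K : R, 0 <= K /\ exists2 r, 0 < r &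
    forall p q, ball x0 r p -> ball x0 r q ->
      `|'D_(e ij.2) (fun p => G p 0 ij.1) p - 'D_(e ij.2) (fun p => G p 0 ij.1) q|
        <= K * `|p - q|.
  by move=> [i j]; have [K K0 ?] := local_lipschitz (cGij i j); exists K.
pose Q (ij : 'I_d * 'I_n) (s : R) := forall p q,
    ball x0 s p -> ball x0 s q ->
    `|'D_(e ij.2) (fun p => G p 0 ij.1) p - 'D_(e ij.2) (fun p => G p 0 ij.1) q|
      <= K ij * `|p - q|.
have HK' : \forall s \near (0 : R)^'+, 0 < s /\ forall ij, Q ij s.
  apply: filterI; first exact: nbhs_right_gt.
  refine (@filter_forall _ _ Q (at_right (0 : R)) _ _) => ij; have [_ [r r0 Hr]] := HK ij.
  have : \forall s \near (0 : R)^'+, s <= r by exact: nbhs_right_le.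
  by apply: filterS => s sr p q /(le_ball sr) ps /(le_ball sr) qs; exact: Hr.
have [r0 /= r00 rU] := (nbhs_ballP _ _).1 (open_nbhs_nbhs (conj Uo Ux)).
have small : \forall s \near (0 : R)^'+, s <= r0 by exact: nbhs_right_le.
have [r [[r_gt0 Hr] rr0]] := filter_ex (filterI HK' small).
have K0 ij : 0 <= K ij by have [] := HK ij.
have S0 : 0 <= \sum_i \sum_j K (i, j).
  by apply: sumr_ge0 => i _; exact: sumr_ge0.
exists (\sum_i \sum_j K (i, j)) => //.
exists r => // p q v pr qr.
have [dp _] := cG1 p (rU _ (le_ball rr0 pr)).
have [dq _] := cG1 q (rU _ (le_ball rr0 qr)).
apply: mx_norm_le => [|i l]; first by rewrite !mulr_ge0.
rewrite (ord1 i) !(derive_coordinates _ LL) // !mxE !summxE -sumrB.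
apply: le_trans (ler_norm_sum _ _ _) _.
apply: (@le_trans _ _ (\sum_(j < n) K (l, j) * `|v| * `|p - q|)).
  apply: ler_sum => j _; rewrite !mxE -mulrBr normrM mulrAC mulrC; apply: ler_pM => //.
    rewrite !derive_mx ?mxE; try exact: diff_derivable.
    exact: (Hr (l, j)).
  by case: LL => _ _ _ _ nL'; apply: le_trans (nL' v); exact: entry_le.
rewrite -!mulr_suml; apply: ler_wpM2r => //; apply: ler_wpM2r => //.
by rewrite [leRHS](bigD1 l) //= lerDl sumr_ge0 // => i1 _; exact: sumr_ge0.
Qed.

End LocalBounds.

(** * The projector field and the Riemannian Hessian *)

Section Gradients.
Context {R : realType} {d : nat}.
Implicit Types (g : 'rV[R]_d -> R) (x u v : 'rV[R]_d).

Lemma smooth_C1_on g : smooth_on setT g -> C1_on setT g.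
Proof.
by move=> sg; apply: (C1_on_C_class (coordinates_rV R d) openT); exact: sg.
Qed.

Lemma nabla_C1_on g : smooth_on setT g -> C1_on setT (nabla g).
Proof.
move=> sg; apply: (C1_on_mx openT) => i j.
have -> : (fun x => nabla g x i j) = 'D_(delta_mx 0 j) g.
  by apply/funext => x; rewrite mxE.
apply: (C1_on_C_class (coordinates_rV R d) openT).
by have [_ /(_ (delta_mx 0 j)) []] := sg 2%N.
Qed.

Lemma derive_nabla g x v : smooth_on setT g -> 'D_v g x = dotp (nabla g x) v.
Proof.
move=> sg; have [dg _] := smooth_C1_on sg (I : setT x).
rewrite (derive_coordinates _ (coordinates_rV R d)) //.
by apply: eq_bigr => j _; rewrite mxE; exact: mulrC.
Qed.

Lemma is_derive_dotp (V : normedModType R) (F : V -> 'rV[R]_d) y w v :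
  derivable F y w -> is_derive y w (fun z => dotp (F z) v) (dotp ('D_w F y) v).
Proof.
move=> dFc.
have E : (fun z => dotp (F z) v) = \sum_(i < d) ((fun z => F z 0 i) * cst (v 0 i)).
  by apply/funext => z; rewrite fct_sumE.
have dFi i : derivable (fun z => F z 0 i) y w.
  exact: ((derivable_mxP _ _ _).1 dFc).
have dM i : derivable ((fun z => F z 0 i) * cst (v 0 i)) y w.
  by apply: derivableM; [exact: dFi|exact: derivable_cst].
rewrite E; apply: DeriveDef; first exact: derivable_sum.
rewrite derive_sum //; apply: eq_bigr => i _; rewrite deriveM;
  [|exact: dFi|exact: derivable_cst].
by rewrite derive_cst scaler0 add0r (derive_mx dFc) mxE; exact: mulrC.
Qed.

(** Symmetry of the Euclidean Hessian, read on the derivative of the gradient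
    field. *)
Lemma derive_nabla_sym g x u v : smooth_on setT g ->
  dotp ('D_u (nabla g) x) v = dotp ('D_v (nabla g) x) u.
Proof.
move=> sg; have [dn _] := nabla_C1_on sg (I : setT x).
have E a b : dotp ('D_a (nabla g) x) b = 'D_a ('D_b g) x.
  have <- : (fun y => dotp (nabla g y) b) = 'D_b g.
    by apply/funext => y; rewrite derive_nabla.
  by apply: esym; have [] := is_derive_dotp b (diff_derivable (v := a) dn).
have S := @schwarz _ _ setT g x u v openT I (sg 2%N).
exact (etrans (E u v) (etrans S (esym (E v u)))).
Qed.

End Gradients.

Lemma dotp_sub_eq (R : realType) d (a b a' b' u w : 'rV[R]_d) :
  dotp a w = dotp a' u -> dotp b w = dotp b' u ->
  dotp (a - b) w = dotp (a' - b') u.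
Proof. by move=> ha hb; rewrite !dotpDl !dotpNl ha hb. Qed.

Lemma dotp_sumZ_eq (R : realType) d m (l : 'I_m -> R) (F G : 'I_m -> 'rV[R]_d)
    (u w : 'rV[R]_d) :
  (forall i, dotp (F i) w = dotp (G i) u) ->
  dotp (\sum_i l i *: F i) w = dotp (\sum_i l i *: G i) u.
Proof.
move=> FG; rewrite !dotpE !mulmx_suml !summxE; apply: eq_bigr => i _.
by rewrite -!scalemxAl [LHS]mxE [RHS]mxE -!dotpE FG.
Qed.

Section Projector.
Context {R : realType} {d m : nat}.
Variable c : 'I_m -> 'rV[R]_d -> R.
Hypothesis sc : forall i, smooth_on setT (c i).

Local Notation A := (constraint_grads c).
Local Notation P := (tan_proj c).

(** The constraint gradients stay independent on an open set around the
    manifold, where the projector field is differentiable. *)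
Definition regular : set 'rV[R]_d := [set y | A y *m (A y)^T \in unitmx].

Lemma gram_unitmx (B : 'M[R]_(m, d)) : row_free B -> B *m B^T \in unitmx.
Proof.
move=> Bfree; rewrite -row_free_unit -kermx_eq0; apply/rowV0P => w /sub_kermxP wG.
apply: (row_free_inj Bfree); rewrite /= mul0mx; apply/eqP.
by rewrite -dotp_eq0 dotpE trmx_mul mulmxA -(mulmxA w) wG mul0mx mxE.
Qed.

Lemma constraint_grads_C1_on : C1_on setT A.
Proof.
apply: (C1_on_mx openT) => i j.
have -> : (fun x => A x i j) = (fun x => nabla (c i) x 0 j).
  by apply/funext => x; rewrite mxE.
exact: (C1_on_coord _ _ openT (nabla_C1_on (sc i))).
Qed.

Lemma open_regular : open regular.
Proof.
have -> : regular = (fun y => \det (A y *m (A y)^T)) @^-1` [set t | t != 0].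
  by apply/seteqP; split => y; rewrite /regular /= unitmxE unitfE.
apply: open_comp; last exact: open_neq.
move=> y _; apply: (@C1_on_continuous _ _ _ setT) => //.
have cA := constraint_grads_C1_on.
exact: (C1_on_det openT (C1_on_mulmx openT cA (C1_on_trmx openT cA))).
Qed.

Lemma tan_proj_C1_on : C1_on regular P.
Proof.
have Uo := open_regular; have cA := C1_on_sub (@subsetT _ regular) constraint_grads_C1_on.
have cAT := C1_on_trmx Uo cA.
have cI := C1_on_invmx Uo (fun _ h => h) (C1_on_mulmx Uo cA cAT).
have cM := C1_on_mulmx Uo (C1_on_mulmx Uo cAT cI) cA.
have -> : P = fun y => cst 1%:M y + (cst (-1) y : R) *:
    ((A y)^T *m invmx (A y *m (A y)^T) *m A y).
  by apply/funext => y; rewrite /= scaleN1r.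
exact: (C1_onD Uo (C1_on_cst _) (C1_onZ Uo (C1_on_cst _) cM)).
Qed.

Lemma constraint_grads_proj y : regular y -> A y *m P y = 0.
Proof.
move=> ry; rewrite /tan_proj mulmxBr mulmx1 !mulmxA mulmxV // mul1mx subrr //.
Qed.

Lemma tan_proj_idem y : regular y -> P y *m P y = P y.
Proof.
move=> ry; rewrite {1}/tan_proj mulmxBl mul1mx -[X in _ - X]mulmxA.
by rewrite constraint_grads_proj // mulmx0 subr0.
Qed.

Lemma tangentE y (u : 'rV[R]_d) : regular y -> (u <= tangent c y)%MS = (u *m P y == u).
Proof.
move=> ry; apply/idP/eqP => [|<-]; first exact: tan_proj_id.
apply/sub_kermxP; rewrite -[RHS]trmxK -[LHS]trmxK; congr (_^T).
by rewrite trmx_mul trmxK trmx_mul tan_proj_sym mulmxA constraint_grads_proj // mul0mx trmx0.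
Qed.

(** Differentiating P^2 = P and multiplying by P on both sides gives twice the
    same term on the left-hand side. *)
Lemma derive_proj_tangent y v : regular y -> P y *m 'D_v P y *m P y = 0.
Proof.
move=> ry; have [dP _] := tan_proj_C1_on ry.
have : 'D_v (fun z => P z *m P z) y = 'D_v P y.
  apply: near_eq_derive; apply: (near_open_eq open_regular) => //.
  by move=> z; exact: tan_proj_idem.
rewrite derive_mulmx // => E; set D := 'D_v P y in E *.
move: (P y) (tan_proj_idem ry) E => Q QQ E.
have : Q *m (D *m Q + Q *m D) *m Q = Q *m D *m Q by rewrite E.
rewrite mulmxDr mulmxDl !mulmxA QQ -(mulmxA (Q *m D)) QQ.
by move/eqP; rewrite -subr_eq0 addrK => /eqP.
Qed.

Variable f : 'rV[R]_d -> R.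
Hypothesis sf : smooth_on setT f.

Lemma rgrad_C1_on : C1_on regular (rgrad c f).
Proof.
have cf := C1_on_sub (@subsetT _ regular) (nabla_C1_on sf).
exact: (C1_on_mulmx open_regular cf tan_proj_C1_on).
Qed.

Lemma mul_rhess y (u : 'rV[R]_d) : regular y ->
  u *m rhess c f y = 'D_u (rgrad c f) y *m P y.
Proof.
by move=> ry; have [dr _] := rgrad_C1_on ry; rewrite /rhess mulmxA deriveEjacobian.
Qed.

(** Near y the gradient field is also the projection of the gradient of
    f - sum_i lambda_i c_i, whose multipliers lambda are frozen at y. That
    gradient is tangent at y, so that the derivative of the projector does not
    contribute to its tangential part. *)
Lemma mul_rhess_lagrangian y : regular y ->
  exists lam : 'rV[R]_m, forall u, u *m rhess c f y =
    ('D_u (nabla f) y - \sum_i lam 0 i *: 'D_u (nabla (c i)) y) *m P y.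
Proof.
move=> ry; pose lam := nabla f y *m (A y)^T *m invmx (A y *m (A y)^T).
exists lam => v; rewrite mul_rhess //.
pose phi z := nabla f z - lam *m A z.
have phiy : phi y = rgrad c f y.
  by rewrite /phi /rgrad /tan_proj /lam mulmxBr mulmx1 !mulmxA.
have [dA _] := constraint_grads_C1_on (I : setT y).
have [dn _] := nabla_C1_on sf (I : setT y).
have [dP _] := tan_proj_C1_on ry.
have dl : differentiable (fun z => lam *m A z) y.
  have cl := C1_on_mulmx openT (@C1_on_cst _ _ _ setT lam) constraint_grads_C1_on.
  by have [] := cl y I.
have dphi : differentiable phi y by exact: differentiableB.
have -> : 'D_v (rgrad c f) y = 'D_v (fun z => phi z *m P z) y.
  apply: near_eq_derive; apply: (near_open_eq open_regular ry) => z rz.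
  rewrite /rgrad /phi (mulmxBl (nabla f z)) -(mulmxA lam) (constraint_grads_proj rz).
  rewrite mulmx0; exact/esym/subr0.
rewrite (derive_mulmx _ dphi dP) mulmxDl phiy.
have -> : rgrad c f y *m 'D_v P y *m P y = 0.
  by rewrite /rgrad -!mulmxA (mulmxA (P y)) derive_proj_tangent // mulmx0.
rewrite addr0 -mulmxA tan_proj_idem //; congr (_ *m _).
have -> : 'D_v phi y = 'D_v (nabla f) y - 'D_v (fun z => lam *m A z) y.
  by rewrite -deriveB //; exact: diff_derivable.
congr (_ - _); rewrite (@derive_mulmx _ _ _ _ _ (cst lam)) //.
rewrite derive_cst mul0mx add0r (derive_mx (diff_derivable dA)).
apply/rowP => j; rewrite mxE summxE; apply: eq_bigr => i _.
rewrite !mxE; congr (_ * _).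
have [dc _] := nabla_C1_on (sc i) (I : setT y).
rewrite (derive_mx (diff_derivable dc)) mxE; congr ('D_v _ y).
by apply/funext => z; rewrite mxE.
Qed.

(** Between tangent vectors the Riemannian Hessian is the Hessian of the
    Lagrangian with frozen multipliers, which is symmetric by Schwarz. *)
Lemma rhess_sym y (u w : 'rV[R]_d) : regular y -> u *m P y = u -> w *m P y = w ->
  dotp (u *m rhess c f y) w = dotp u (w *m rhess c f y).
Proof.
move=> ry uP wP; have [lam E] := mul_rhess_lagrangian ry.
have K v z : z *m P y = z -> dotp (v *m P y) z = dotp v z.
  by move=> zP; rewrite dotp_mul tan_proj_sym zP.
pose X v := 'D_v (nabla f) y - \sum_i lam 0 i *: 'D_v (nabla (c i)) y.
have XE v z : z *m P y = z -> dotp (v *m rhess c f y) z = dotp (X v) z.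
  by move=> zP; rewrite (E v); exact: K.
have Ssym : dotp (\sum_i lam 0 i *: 'D_u (nabla (c i)) y) w =
    dotp (\sum_i lam 0 i *: 'D_w (nabla (c i)) y) u.
  apply: dotp_sumZ_eq => i; exact: derive_nabla_sym.
have Xsym : dotp (X u) w = dotp (X w) u.
  exact: dotp_sub_eq (derive_nabla_sym y u w sf) Ssym.
exact: etrans (XE u w wP) (etrans Xsym (etrans (esym (XE w u uP)) (dotpC _ _))).
Qed.

Lemma rhess_proj y : regular y -> rhess c f y *m P y = rhess c f y.
Proof. by move=> ry; rewrite /rhess -mulmxA tan_proj_idem. Qed.

End Projector.

(** * Lengths of curves *)

Section Increments.
Context {R : realType}.
Local Notation mu := (@lebesgue_measure R).

Lemma countable_seq_set (s : seq R) : countable [set t | t \in s].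
Proof. by apply: finite_set_countable; exact: finite_seq. Qed.

Lemma open_itv_off_seq (a b : R) (s : seq R) : open (`]a, b[ `\` [set` s]).
Proof.
rewrite setDE; apply: openI; first exact: interval_open.
apply: closed_openC; apply: (accessible_finite_set_closed.1 _); last first.
  exact: finite_seq.
exact/hausdorff_accessible/Rhausdorff.
Qed.

Lemma measurable_off_seq (a b : R) (s : seq R) (h : R -> R) :
  (forall t, `]a, b[%classic t -> t \notin s -> {for t, continuous h}) ->
  measurable_fun `]a, b[ h.
Proof.
move=> ch.
have mS A : A `<=` [set` s] -> measurable A.
  move=> As; apply: countable_measurable => [t|]; first exact: measurable_set1.
  exact: sub_countable (subset_card_le As) (countable_seq_set s).
have -> : `]a, b[%classic = (`]a, b[ `\` [set` s]) `|` (`]a, b[ `&` [set` s]).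
  by rewrite setUC setUIDK.
apply/measurable_funU.
- by apply: open_measurable; exact: open_itv_off_seq.
- by apply: mS => t [].
split.
- apply: open_continuous_measurable_fun.
    exact: open_itv_off_seq.
  by move=> t; rewrite inE => -[tab ts]; apply: ch => //; exact/negP.
by move=> _ Y _; apply: mS => t [[]].
Qed.

(** Between consecutive points of s this is the fundamental theorem of
    calculus, on segments that exhaust the open interval since nothing is known
    of the derivative at its ends. *)
Lemma increment_le_integral (phi F : R -> R) (s : seq R) (a b : R) :
  a <= b -> {within `[a, b], continuous phi} ->
  (forall t, `]a, b[%classic t -> t \notin s ->
     [/\ derivable phi t 1, {for t, continuous (derive1 phi)} & `|derive1 phi t| <= F t]) ->
  (forall t, 0 <= F t) -> measurable_fun `]a, b[ F ->
  (`|phi b - phi a|%:E <= \int[mu]_(t in `]a, b[) (F t)%:E)%E.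
Proof.
elim: s a b => [|p s IH] a b; rewrite le_eqVlt => /predU1P[<-|ab] cphi dphi F0 mF.
- rewrite subrr normr0; apply: integral_ge0 => t _; rewrite lee_fin; exact: F0.
- have inner a' b' : a < a' -> a' < b' -> b' < b ->
      (`|phi b' - phi a'|%:E <= \int[mu]_(t in `]a, b[) (F t)%:E)%E.
    move=> aa' a'b' b'b.
    have sub t : t \in `[a', b'] -> `]a, b[%classic t.
      by rewrite /= !in_itv /= => /andP[h1 h2]; apply/andP; split; lra.
    have dd t : t \in `[a', b'] -> derivable phi t 1.
      by move=> /sub tab; have [] := dphi t tab isT.
    have cd : {within `[a', b'], continuous (derive1 phi)}.
      apply: continuous_in_subspaceT => t; rewrite inE => /sub tab.
      by have [] := dphi t tab isT.
    have mF' : measurable_fun `[a', b'] F.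
      by apply: measurable_funS mF => // t; exact: sub.
    have md : measurable_fun `[a', b'] (derive1 phi).
      by apply: subspace_continuous_measurable_fun => //.
    have ftc : (\int[mu]_(t in `[a', b']) (derive1 phi t)%:E =
        (phi b')%:E - (phi a')%:E)%E.
      apply: continuous_FTC2 => //; split.
      - by move=> t tab; apply: dd; exact: subset_itv_oo_cc.
      - apply: cvg_at_right_filter; apply: differentiable_continuous.
        by apply/derivable1_diffP/dd; rewrite in_itv /= lexx ltW.
      - apply: cvg_at_left_filter; apply: differentiable_continuous.
        by apply/derivable1_diffP/dd; rewrite in_itv /= lexx ltW.
    rewrite -abse_EFin EFinB -ftc.
    apply: le_trans (le_abse_integral _ _ _) _ => //.
      exact/measurable_EFinP.
    apply: (@le_trans _ _ (\int[mu]_(t in `[a', b']) (F t)%:E)%E).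
      apply: ge0_le_integral => //.
      - apply: measurableT_comp => //; exact/measurable_EFinP.
      - exact/measurable_EFinP.
      by move=> t /sub tab; rewrite lee_fin; have [] := dphi t tab isT.
    apply: ge0_subset_integral => //; first exact/measurable_EFinP.
    by move=> t _; rewrite lee_fin; exact: F0.
  set J := (\int[mu]_(t in _) _)%E in inner *.
  have J0 : (0 <= J)%E by apply: integral_ge0 => t _; rewrite lee_fin; exact: F0.
  case: J J0 inner => [r r0 inner| _ _|//]; last by rewrite leey.
  rewrite lee_fin; apply/ler_addgt0Pr => e e0.
  have [_ cra clb] := (continuous_within_itvP phi ab).1 cphi.
  have e2 : 0 < e / 2 by rewrite divr_gt0.
  have [a' [[aa' a'm] ha']] : exists a', (a < a' /\ a' < (a + b) / 2) /\
      `|phi a - phi a'| <= e / 2.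
    have /cvgrPdist_le/(_ _ e2) na := cra.
    have am : a < (a + b) / 2 by lra.
    exact: (filter_ex (filterI (filterI (nbhs_right_gt a) (nbhs_right_lt am)) na)).
  have [b' [[b'b mb'] hb']] : exists b', (b' < b /\ (a + b) / 2 < b') /\
      `|phi b - phi b'| <= e / 2.
    have /cvgrPdist_le/(_ _ e2) nb := clb.
    have mb : (a + b) / 2 < b by lra.
    exact: (filter_ex (filterI (filterI (nbhs_left_lt b) (nbhs_left_gt mb)) nb)).
  have := inner a' b' aa' (lt_trans a'm mb') b'b; rewrite lee_fin.
  move: ha' hb'; move: (phi a) (phi b) (phi a') (phi b') => x1 x2 x3 x4.
  rewrite !ler_norml => /andP[? ?] /andP[? ?] /andP[? ?]; apply/andP; split; lra.
- rewrite subrr normr0; apply: integral_ge0 => t _; rewrite lee_fin; exact: F0.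
have [|pab] := boolP (p \in `]a, b[); last first.
  apply: IH => //; first exact: ltW.
  move=> t tab ts; apply: dphi => //; rewrite in_cons negb_or ts andbT.
  by apply: contra pab => /eqP <-.
rewrite in_itv /= => /andP[ap pb].
have subl : `]a, p[%classic `<=` `]a, b[%classic.
  by move=> t; rewrite /= !in_itv /= => /andP[-> h]; exact: lt_trans pb.
have subr : `]p, b[%classic `<=` `]a, b[%classic.
  by move=> t; rewrite /= !in_itv /= => /andP[h ->]; rewrite (lt_trans ap).
have L : (`|phi p - phi a|%:E <= \int[mu]_(t in `]a, p[) (F t)%:E)%E.
  apply: IH => //; first exact: ltW.
  - apply: continuous_subspaceW cphi => t; rewrite /= !in_itv /= => /andP[-> h].
    by rewrite (le_trans h (ltW pb)).
  - move=> t tap ts; apply: dphi; first exact: subl.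
    rewrite in_cons negb_or ts andbT; move: tap; rewrite /= in_itv /=.
    by case/andP => _ tp; rewrite lt_eqF.
  by apply: measurable_funS mF.
have Rr : (`|phi b - phi p|%:E <= \int[mu]_(t in `]p, b[) (F t)%:E)%E.
  apply: IH => //; first exact: ltW.
  - apply: continuous_subspaceW cphi => t; rewrite /= !in_itv /= => /andP[h ->].
    by rewrite (le_trans (ltW ap) h).
  - move=> t tpb ts; apply: dphi; first exact: subr.
    rewrite in_cons negb_or ts andbT; move: tpb; rewrite /= in_itv /=.
    by case/andP => pt _; rewrite gt_eqF.
  by apply: measurable_funS mF.
apply: (@le_trans _ _ (\int[mu]_(t in `]a, p[ `|` `]p, b[) (F t)%:E)%E).
  rewrite ge0_integral_setU //=.
  - apply: le_trans (leeD L Rr); rewrite -EFinD lee_fin.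
    by rewrite -(subrKA (phi p)) addrC ler_normD.
  - by apply/measurable_EFinP; apply: measurable_funS mF => // t [/subl|/subr].
  - by move=> t _; rewrite lee_fin; exact: F0.
  apply/disj_setPS => t [] /=; rewrite !in_itv /= => /andP[_ h1] /andP[h2 _].
  by have := lt_trans h1 h2; rewrite ltxx.
apply: ge0_subset_integral => //.
- exact: measurableU.
- exact/measurable_EFinP.
- by move=> t _; rewrite lee_fin; exact: F0.
by move=> t [/subl|/subr].
Qed.

End Increments.

Section Curves.
Context {R : realType} {d m : nat}.
Variable c : 'I_m -> 'rV[R]_d -> R.
Implicit Types (g : R -> 'rV[R]_d) (s : seq R).
Local Notation mu := (@lebesgue_measure R).

Definition C1_off s g : Prop := forall t : R, `]0, 1[%classic t -> t \notin s ->
  derivable g t 1 /\ {for t, continuous (derive1 g)}.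

Lemma continuous_dotpl (v : 'rV[R]_d) : continuous (fun u : 'rV[R]_d => dotp u v).
Proof.
move=> u; apply: continuous_sum => i.
by apply: continuousM; [exact: coord_continuous|exact: cst_continuous].
Qed.

Lemma continuous_enorm : continuous (@enorm R d).
Proof.
move=> u; apply: (@continuous_comp _ _ _ (fun u : 'rV[R]_d => dotp u u) Num.sqrt).
  apply: continuous_sum => i.
  by apply: continuousM; exact: coord_continuous.
exact: sqrt_continuous.
Qed.

Lemma measurable_speed s g : C1_off s g ->
  measurable_fun (`]0, 1[%classic : set R) (fun t => enorm (derive1 g t)).
Proof.
move=> cg; apply: (@measurable_off_seq _ _ _ s) => t t01 ts.
have [_ cd] := cg t t01 ts.
apply: (@continuous_comp _ _ _ (derive1 g) enorm) => //; exact: continuous_enorm.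
Qed.

(** The increment estimate is applied to the component of the curve along its
    own displacement u, and the resulting inequality is divided by |u|. *)
Lemma displacement_le_length g s (a b : R) :
  {within `[0, 1], continuous g} -> C1_off s g ->
  0 <= a -> a <= b -> b <= 1 ->
  ((enorm (g b - g a))%:E <= curve_length g)%E.
Proof.
move=> cg dg a0 ab b1; set u := g b - g a.
have [u0|u0] := eqVneq (enorm u) 0.
  by rewrite u0; apply: integral_ge0 => t _; rewrite lee_fin enorm_ge0.
have up : 0 < enorm u by rewrite lt_neqAle eq_sym u0 enorm_ge0.
have ms := measurable_speed dg.
have sub01 : `]a, b[%classic `<=` `]0%R, 1%R[%classic.
  move=> t; rewrite /= !in_itv /= => /andP[h1 h2].
  by rewrite (le_lt_trans a0 h1) (lt_le_trans h2 b1).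
pose phi t := dotp (g t) u.
pose F t := enorm u * enorm (derive1 g t).
have mF : measurable_fun (`]0, 1[%classic : set R) F.
  by apply: measurable_funM => //; exact: measurable_cst.
have H : (`|phi b - phi a|%:E <= \int[mu]_(t in `]a, b[) (F t)%:E)%E.
  apply: (@increment_le_integral _ phi F s) => //.
  - have sub : `[a, b]%classic `<=` `[0%R, 1%R]%classic.
      move=> t; rewrite /= !in_itv /= => /andP[h1 h2].
      by rewrite (le_trans a0 h1) (le_trans h2 b1).
    have cgab := continuous_subspaceW sub cg.
    move=> t; apply: (@continuous_comp _ _ _ (g : subspace _ -> _) (fun w => dotp w u)).
      exact: cgab.
    exact: continuous_dotpl.
  - move=> t /sub01 t01 ts; have [dgt cdt] := dg t t01 ts.
    have E : \forall z \near t, dotp (derive1 g z) u = derive1 phi z.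
      have Dt : (`]0, 1[ `\` [set` s])%classic t by split => //; exact/negP.
      apply: (near_open_eq (@open_itv_off_seq R 0 1 s) Dt) => z [z01 /negP zs].
      have [dgz _] := dg z z01 zs.
      by rewrite !derive1E; have [_ ->] := is_derive_dotp u dgz.
    have Et := nbhs_singleton E.
    split.
    - by have [] := is_derive_dotp u dgt.
    - apply: continuous_near_eq E _.
      apply: (@continuous_comp _ _ _ (derive1 g) (fun w => dotp w u)) => //.
      exact: continuous_dotpl.
    by rewrite -Et /F mulrC; exact: dotp_le.
  - by move=> t; rewrite mulr_ge0 // enorm_ge0.
  by apply: measurable_funS mF.
have : ((enorm u * enorm u)%:E <= (enorm u)%:E * curve_length g)%E.
  have -> : enorm u * enorm u = `|phi b - phi a|.
    rewrite -expr2 sqr_enorm ger0_norm; first by rewrite /phi -dotpNl -dotpDl.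
    by rewrite /phi -dotpNl -dotpDl dotp_ge0.
  apply: le_trans H _; rewrite /curve_length -ge0_integralZl_EFin //.
  - apply: ge0_subset_integral => //.
    - exact/measurable_EFinP.
    by move=> t _; rewrite lee_fin mulr_ge0 // enorm_ge0.
  - by move=> t _; rewrite lee_fin enorm_ge0.
  - exact/measurable_EFinP.
  exact: ltW.
by rewrite EFinM lee_pmul2l.
Qed.

Lemma length_le_scale (g1 g2 : R -> 'rV[R]_d) s1 s2 (q : R) : 0 <= q ->
  C1_off s1 g1 -> C1_off s2 g2 ->
  (forall t, `]0, 1[%classic t -> t \notin s1 ->
    enorm (derive1 g2 t) <= q * enorm (derive1 g1 t)) ->
  (curve_length g2 <= q%:E * curve_length g1)%E.
Proof.
move=> q0 c1 c2 H.
pose F1 (t : R) := enorm (derive1 g1 t); pose F2 (t : R) := enorm (derive1 g2 t).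
pose F3 t := q * F1 t; pose D : set R := `]0, 1[%classic.
have mD : measurable D by exact: measurable_itv.
have m1 : measurable_fun D (EFin \o F1) by apply/measurable_EFinP; exact: measurable_speed c1.
have m2 : measurable_fun D (EFin \o F2) by apply/measurable_EFinP; exact: measurable_speed c2.
have m3 : measurable_fun D (EFin \o F3).
  apply/measurable_EFinP; apply: measurable_funM; first exact: measurable_cst.
  exact: measurable_speed c1.
have F10 t : 0 <= F1 t by exact: enorm_ge0.
have -> : (q%:E * curve_length g1 = \int[mu]_(t in D) (q * F1 t)%:E)%E.
  have F1e t : D t -> (0 <= (EFin \o F1) t)%E by move=> _; rewrite lee_fin.
  exact/esym/(@ge0_integralZl_EFin _ _ _ mu D mD (EFin \o F1) F1e m1 q q0).
have F2e t : D t -> (0 <= (EFin \o F2) t)%E by rewrite lee_fin enorm_ge0.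
have F3e t : D t -> (0 <= (EFin \o F3) t)%E.
  by rewrite lee_fin mulr_ge0.
refine (@ae_ge0_le_integral _ _ _ mu D mD (EFin \o F2)
  (EFin \o F3) F2e m2 F3e m3 _).
exists [set t | t \in s1]; split.
- apply: countable_measurable (countable_seq_set s1) => t; exact: measurable_set1.
- exact: countable_lebesgue_measure0 (countable_seq_set s1).
move=> t /=; apply: contra_notP => ts t01; rewrite lee_fin; apply: H => //.
exact/negP.
Qed.

(** A curve in the manifold is a common zero of the constraints, whose
    derivatives along it vanish. *)
Lemma velocity_tangent g t : (forall i, smooth_on setT (c i)) ->
  (forall z : R, `[0, 1]%classic z -> manifold c (g z)) ->
  `]0, 1[%classic t -> derivable g t 1 -> (derive1 g t <= tangent c (g t))%MS.
Proof.
move=> sc gM t01 dg; apply/sub_kermxP; apply/rowP => i; rewrite [RHS]mxE.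
have -> : (derive1 g t *m (constraint_grads c (g t))^T) 0 i =
    dotp (nabla (c i) (g t)) (derive1 g t).
  rewrite dotpC mxE; apply: eq_bigr => j _; by rewrite !mxE.
rewrite -derive_nabla // derive1E.
have [dc _] := smooth_C1_on (sc i) (I : setT (g t)).
have dg' : differentiable g t by exact/derivable1_diffP.
rewrite -(derive_comp (1 : R) dg' dc).
have -> : 'D_(1 : R) (c i \o g) t = 'D_(1 : R) (cst 0) t.
  apply: near_eq_derive; apply: (near_open_eq (interval_open _ _) t01) => // z z01.
  by apply: gM; exact: subset_itv_oo_cc.
exact: derive_cst.
Qed.

Lemma derive1_C1_on s g : C1_off s g -> C1_on (`]0, 1[ `\` [set` s]) g.
Proof.
move=> cg t [t01 /negP ts]; have [dg cd] := cg t t01 ts.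
split; first exact: (derivable1_diffP _ _).1 dg.
move=> v.
have cv : {for t, continuous (fun z => v *: derive1 g z)}.
  by apply: continuousZl_tmp.
apply: continuous_near_eq cv.
have Dt : (`]0, 1[ `\` [set` s])%classic t by split => //; exact/negP.
apply: (near_open_eq (@open_itv_off_seq R 0 1 s) Dt) => z [z01 /negP zs].
have [dgz _] := cg z z01 zs.
have dz := (derivable1_diffP _ _).1 dgz.
by rewrite (deriveE v dz) (deriv1E dgz).
Qed.

Lemma push_curve_C1_off s g (U : set 'rV[R]_d) (Gam : 'rV[R]_d -> 'rV[R]_d) :
  C1_on U Gam -> C1_off s g -> (forall t, `[0, 1]%classic t -> U (g t)) ->
  C1_off s (Gam \o g) /\
  forall t : R, `]0, 1[%classic t -> t \notin s ->
    derive1 (Gam \o g) t = 'D_(derive1 g t) Gam (g t).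
Proof.
move=> cG cg gU; have cg' := derive1_C1_on cg.
have inU t : (`]0, 1[ `\` [set` s])%classic t -> U (g t).
  by move=> [t01 _]; apply: gU; exact: subset_itv_oo_cc.
have cGg := C1_on_comp (coordinates_rV R d) (@open_itv_off_seq R 0 1 s) inU cg' cG.
split=> t t01 ts; have Dt : (`]0, 1[ `\` [set` s])%classic t.
- by split => //; exact/negP.
- have [dGg cdGg] := cGg t Dt; split; first exact: diff_derivable.
  have -> : derive1 (Gam \o g) = 'D_1 (Gam \o g).
    by apply/funext => z; rewrite derive1E.
  exact: cdGg.
- by split => //; exact/negP.
have [dG _] := cG _ (inU t Dt); have [dgt _] := cg' t Dt.
by rewrite !derive1E; exact: derive_comp.
Qed.

End Curves.

(** * The flipped Hessian contracts *)

Section HessianContraction.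
Context {R : realType} {d m : nat}.
Variables (c : 'I_m -> 'rV[R]_d -> R) (f : 'rV[R]_d -> R).
Hypotheses (sc : forall i, smooth_on setT (c i)) (sf : smooth_on setT f).

Lemma hess_spectrum_unique x (lam lam' : (d - m).-tuple R) :
  hess_spectrum c f x lam -> hess_spectrum c f x lam' -> lam = lam'.
Proof.
move=> [s1 e1] [s2 e2]; apply: val_inj.
apply: (sorted_eq le_trans le_anti s1 s2).
by apply: prod_XsubC_eq; rewrite -e1 e2.
Qed.

Lemma stable_tangent x : row_free (constraint_grads c x) ->
  stablemx (tangent c x) (rhess c f x).
Proof.
move=> fx; rewrite /rhess mulmxA; apply/row_subP => i.
by rewrite row_mul; exact: tan_proj_sub.
Qed.

(** The eigenvalues left for eigenvectors orthogonal to the v i are the last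
    ones of the list, so that the hypothesis on the spectrum puts the flipped
    Hessian between mu and L. *)
Lemma hessian_contraction (k : nat) x (v : 'I_k -> 'rV[R]_d)
    (lam : (d - m).-tuple R) (mu L t : R) (u : 'rV[R]_d) :
  row_free (constraint_grads c x) -> (k < d - m)%N ->
  0 < mu -> mu < L -> 0 <= t -> t * L <= 1 ->
  hess_spectrum c f x lam ->
  (forall i, (i < d - m)%N ->
     if (i < k)%N then - L <= lam`_i <= - mu else mu <= lam`_i <= L) ->
  smallest_eigenvectors c f x v ->
  enorm (u *m (1%:M - t *: flipped (tan_proj c x) (rhess c f x) v mu))
    <= (1 - t * mu) * enorm u.
Proof.
move=> fx kd mu0 muL t0 tL sp bd [vT vON [lam' sp' vH]].
have rx : regular c x by exact: gram_unitmx.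
have El : lam' = lam by exact: hess_spectrum_unique sp' sp.
rewrite {}El in vH.
apply: (@flipped_contraction _ _ _ _ _ v (fun i => lam`_i) mu L) => //.
- exact: tan_proj_sym.
- exact: tan_proj_idem.
- exact: rhess_proj.
- by move=> u1 u2 h1 h2; exact: rhess_sym.
- by move=> i; exact: tan_proj_id.
- exact: ltW.
- by move=> i; have := bd i (ltn_trans (ltn_ord i) kd); rewrite ltn_ord.
move=> a w w0 wP wH wv.
have wT : (w <= tangent c x)%MS by rewrite tangentE // wP.
have [_ ch] := sp.
have := orthogonal_eigenvalue_mem (stable_tangent fx) ch kd vT vON vH w0 wT wH wv.
move=> /(nthP 0)[j]; rewrite size_drop size_tuple => jd; rewrite nth_drop => <-.
have kj : (k + j < d - m)%N by rewrite -ltn_subRL.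
by have := bd _ kj; rewrite ltnNge leq_addr.
Qed.

Lemma reflection_norm (k : nat) (v : 'I_k -> 'rV[R]_d) :
  orthonormal_family v -> `|reflection v| <= 1 + 2 * k%:R * d%:R.
Proof.
move=> vON; have v1 i : `|v i| <= 1.
  by apply: le_trans (norm_le_enorm _) _; rewrite /enorm vON eqxx sqrtr1.
apply: le_trans (ler_normB _ _) _; apply: lerD.
  by apply: mx_norm_le => // i j; rewrite mxE; case: eqP => _; rewrite ?normr1 ?normr0.
rewrite normrZ ger0_norm // -mulrA; apply: ler_wpM2l => //.
apply: le_trans (ler_norm_sum _ _ _) _.
apply: (@le_trans _ _ (\sum_(i < k) d%:R)); last first.
  by rewrite sumr_const card_ord mulr_natl.
apply: ler_sum => i _; apply: le_trans (mulmx_norm _ _) _.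
have d1 : (1 : R) <= d%:R.
  case: d v vON v1 => [|n] v' vON' v1'; last by rewrite ler1n.
  have := vON' i i; rewrite eqxx /dotp big_ord0 => /eqP.
  by rewrite eq_sym oner_eq0.
apply: le_trans d1; rewrite mul1r; apply: mulr_ile1 => //.
by apply: le_trans (trmx_norm _) _.
Qed.

End HessianContraction.

(** * Error estimate for the pushed velocity *)

(** The displacement field is w = - r S Py, where r stands for the gradient and
    Py for the projector at the current point y; rho and Pi are the derivatives
    of r and of the projector in the direction eta, so that zeta below is the
    derivative of w; primes and Px refer to the frozen point x. A single
    constant K bounds everything in sight, and eps measures the distance to the
    saddle point: each error term is a power of K times eps |eta|. *)
Section Estimate.
Context {R : realType} {d : nat}.
Variables (K eps n mu : R) (eta rho rho' r : 'rV[R]_d) (S Px Py Pi : 'M[R]_d).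
Hypotheses (K1 : 1 <= K) (dK : d%:R <= K) (eps0 : 0 <= eps) (eps1 : eps <= 1).
Hypotheses (n0 : 0 <= n) (mu0 : 0 <= mu) (muK : mu <= K).
Hypotheses (etan : `|eta| <= n) (SK : `|S| <= K) (PxK : `|Px| <= K) (PyK : `|Py| <= K).
Hypotheses (PiK : `|Pi| <= K * n) (rhoK : `|rho| <= K * n).
Hypothesis rhorho' : `|rho' - rho| <= 4 * K ^+ 2 * eps * n.
Hypotheses (reps : `|r| <= eps) (PxPy : `|Px - Py| <= 2 * eps).
Hypotheses (etaP : eta *m Py = eta) (PyPy : Py *m Py = Py).

Lemma mulmx_norm_le p (A : 'M[R]_(p, d)) (B : 'M[R]_d) a b :
  `|A| <= a -> `|B| <= b -> `|A *m B| <= K * a * b.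
Proof.
move=> Aa Bb; apply: le_trans (mulmx_norm _ _) _.
by apply: ler_pM => //; apply: ler_pM.
Qed.

Let K0 : 0 <= K. Proof. exact: le_trans K1. Qed.

Let powK i j a : 0 <= a -> (i <= j)%N -> K ^+ i * a <= K ^+ j * a.
Proof. by move=> a0 ij; apply: ler_wpM2r => //; exact: ler_weXn2l. Qed.

Let en0 : 0 <= eps * n. Proof. exact: mulr_ge0. Qed.

Let rS : `|r *m S| <= K ^+ 2 * eps.
Proof. by apply: le_trans (mulmx_norm_le reps SK) _; rewrite mulrAC -expr2. Qed.

Lemma displacement_bound : `|r *m S *m Py| <= K ^+ 4 * eps.
Proof.
apply: le_trans (mulmx_norm_le rS PyK) _.
by rewrite [leLHS](_ : _ = K ^+ 4 * eps) //; ring.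
Qed.

Let rSPi : `|r *m S *m Pi| <= K ^+ 4 * (eps * n).
Proof.
apply: le_trans (mulmx_norm_le rS PiK) _.
by rewrite [leLHS](_ : _ = K ^+ 4 * (eps * n)) //; ring.
Qed.

Let rSPiP : `|r *m S *m Pi *m Py| <= K ^+ 6 * (eps * n).
Proof.
apply: le_trans (mulmx_norm_le rSPi PyK) _.
by rewrite [leLHS](_ : _ = K ^+ 6 * (eps * n)) //; ring.
Qed.

Let zeta := - (rho *m S *m Py + r *m S *m Pi).

Lemma zeta_bound : `|zeta| <= 2 * K ^+ 5 * n.
Proof.
rewrite normrN; apply: le_trans (ler_normD _ _) _.
have h1 : `|rho *m S *m Py| <= K ^+ 5 * n.
  apply: le_trans (mulmx_norm_le (mulmx_norm_le rhoK SK) PyK) _.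
  by rewrite [leLHS](_ : _ = K ^+ 5 * n) //; ring.
have h2 : `|r *m S *m Pi| <= K ^+ 5 * n.
  apply: le_trans rSPi _; apply: (@le_trans _ _ (K ^+ 4 * n)).
    apply: ler_wpM2l; first exact: exprn_ge0.
    by rewrite ler_piMl.
  exact: powK.
by rewrite -mulrA mulr2n mulrDl !mul1r lerD.
Qed.

Let zetaP : zeta *m Py = - (rho *m S *m Py) - r *m S *m Pi *m Py.
Proof. by rewrite mulNmx mulmxDl -(mulmxA (rho *m S)) PyPy opprD. Qed.

Lemma zeta_normal_bound : `|zeta - zeta *m Py| <= 2 * K ^+ 6 * (eps * n).
Proof.
have -> : zeta - zeta *m Py = r *m S *m Pi *m Py - r *m S *m Pi.
  rewrite zetaP /zeta.
  move: (rho *m S *m Py) (r *m S *m Pi) (r *m S *m Pi *m Py) => a b e.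
  by apply/rowP => j; rewrite !mxE; ring.
apply: le_trans (ler_normB _ _) _.
rewrite -mulrA mulr2n mulrDl !mul1r lerD //.
by apply: le_trans rSPi _; exact: powK.
Qed.

Lemma zeta_tangent_bound :
  `|zeta *m Py + (rho' *m S *m Px + mu *: (eta - eta *m Px))| <=
    9 * K ^+ 6 * (eps * n).
Proof.
have -> : zeta *m Py + (rho' *m S *m Px + mu *: (eta - eta *m Px)) =
    (rho' - rho) *m S *m Px + rho *m S *m (Px - Py) - r *m S *m Pi *m Py
      + mu *: (eta *m (Py - Px)).
  rewrite zetaP !mulmxBl !mulmxBr etaP.
  move: (rho *m S *m Py) (r *m S *m Pi *m Py) (rho' *m S *m Px) (rho *m S *m Px)
    (eta *m Px) => a1 a2 a3 a4 a5.
  by apply/rowP => j; rewrite !mxE; ring.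
have h1 : `|(rho' - rho) *m S *m Px| <= 4 * K ^+ 6 * (eps * n).
  apply: le_trans (mulmx_norm_le (mulmx_norm_le rhorho' SK) PxK) _.
  by rewrite [leLHS](_ : _ = 4 * K ^+ 6 * (eps * n)) //; ring.
have h2 : `|rho *m S *m (Px - Py)| <= 2 * (K ^+ 6 * (eps * n)).
  apply: le_trans (mulmx_norm_le (mulmx_norm_le rhoK SK) PxPy) _.
  rewrite [leLHS](_ : _ = 2 * (K ^+ 4 * (eps * n))); last by ring.
  by rewrite ler_pM2l //; exact: powK.
have h4 : `|mu *: (eta *m (Py - Px))| <= 2 * (K ^+ 6 * (eps * n)).
  have PyPx : `|Py - Px| <= 2 * eps by rewrite distrC.
  rewrite normrZ ger0_norm //.
  apply: (@le_trans _ _ (K * (K * n * (2 * eps)))).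
    by apply: ler_pM => //; exact: mulmx_norm_le.
  rewrite [leLHS](_ : _ = 2 * (K ^+ 2 * (eps * n))); last by ring.
  by rewrite ler_pM2l //; exact: powK.
have h3 := rSPiP.
apply: le_trans (ler_normD _ _) _.
apply: (@le_trans _ _ (4 * K ^+ 6 * (eps * n) + 2 * (K ^+ 6 * (eps * n)) +
    K ^+ 6 * (eps * n) + 2 * (K ^+ 6 * (eps * n)))).
  apply: lerD => //; apply: le_trans (ler_normB _ _) _.
  apply: lerD => //; apply: le_trans (ler_normD _ _) _.
  exact: lerD.
by rewrite [leLHS](_ : _ = 9 * K ^+ 6 * (eps * n)) //; ring.
Qed.

(** D1 + t D2 is the velocity of the pushed curve: D1 is the derivative of the
    retraction in the base variable, D2 the one in the fiber variable, at the
    displaced point, and theta is D2 at the zero section. The point is that the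
    whole error carries a factor t: it must be dominated by the gain t mu of the
    contraction for all step sizes, including arbitrarily small ones. *)
Lemma velocity_error (t : R) (D1 D2 theta : 'rV[R]_d) :
  0 <= t -> t <= K ->
  `|D1 - eta| <= K * n * (t * (K ^+ 4 * eps)) ->
  `|theta - zeta *m Py| <= K * `|zeta - zeta *m Py| ->
  `|D2 - theta| <= K * `|zeta| * (t * (K ^+ 4 * eps)) ->
  `|D1 + t *: D2 - (eta - t *: (rho' *m S *m Px + mu *: (eta - eta *m Px)))|
    <= t * (14 * K ^+ 11 * (eps * n)).
Proof.
move=> t0 tK h1 h2 h3.
set A := rho' *m S *m Px + _.
have -> : D1 + t *: D2 - (eta - t *: A) = (D1 - eta) +
    t *: ((D2 - theta) + (theta - zeta *m Py) + (zeta *m Py + A)).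
  move: (zeta *m Py) A => z A'.
  by apply/rowP => j; rewrite !mxE; ring.
have b1 : `|D1 - eta| <= t * (K ^+ 11 * (eps * n)).
  apply: le_trans h1 _.
  rewrite [leLHS](_ : _ = t * (K ^+ 5 * (eps * n))); last by ring.
  by apply: ler_wpM2l => //; exact: powK.
have b2 : `|theta - zeta *m Py| <= 2 * (K ^+ 11 * (eps * n)).
  apply: le_trans h2 _.
  apply: le_trans (ler_wpM2l K0 zeta_normal_bound) _.
  rewrite [leLHS](_ : _ = 2 * (K ^+ 7 * (eps * n))); last by ring.
  by rewrite ler_pM2l //; exact: powK.
have b3 : `|D2 - theta| <= 2 * (K ^+ 11 * (eps * n)).
  apply: le_trans h3 _.
  apply: (@le_trans _ _ (K * (2 * K ^+ 5 * n) * (K * (K ^+ 4 * eps)))).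
    have KKe : 0 <= K ^+ 4 * eps by rewrite mulr_ge0 // exprn_ge0.
    apply: ler_pM; rewrite ?mulr_ge0 //.
      by apply: ler_wpM2l => //; exact: zeta_bound.
    exact: ler_wpM2r.
  by rewrite [leLHS](_ : _ = 2 * (K ^+ 11 * (eps * n))) //; ring.
have b4 : `|zeta *m Py + A| <= 9 * (K ^+ 11 * (eps * n)).
  apply: le_trans zeta_tangent_bound _; rewrite -mulrA ler_pM2l //.
  exact: powK.
apply: le_trans (ler_normD _ _) _; rewrite normrZ (ger0_norm t0).
apply: (@le_trans _ _ (t * (K ^+ 11 * (eps * n)) +
    t * (2 * (K ^+ 11 * (eps * n)) + 2 * (K ^+ 11 * (eps * n)) +
         9 * (K ^+ 11 * (eps * n))))).
  apply: lerD => //; apply: ler_wpM2l => //; apply: le_trans (ler_normD _ _) _.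
  apply: lerD => //; apply: le_trans (ler_normD _ _) _; exact: lerD.
by rewrite [leLHS](_ : _ = t * (14 * K ^+ 11 * (eps * n))) //; ring.
Qed.

End Estimate.

(** * Pushing curves by one step with a frozen reflection *)

Section PairMaps.
Context {R : realType} {V V1 V2 : normedModType R}.

Lemma derive_pair (f : V -> V1) (g : V -> V2) x v :
  differentiable f x -> differentiable g x ->
  'D_v (fun y => (f y, g y)) x = ('D_v f x, 'D_v g x).
Proof.
move=> df dg; rewrite deriveE; last exact: differentiable_pair.
by rewrite diff_pair // !deriveE.
Qed.

Lemma C1_on_pair (U : set V) (f : V -> V1) (g : V -> V2) : open U ->
  C1_on U f -> C1_on U g -> C1_on U (fun y => (f y, g y)).
Proof.
move=> Uo cf cg x Ux; have [df cdf] := cf x Ux; have [dg cdg] := cg x Ux.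
split; first exact: differentiable_pair.
move=> v; have C : {for x, continuous (fun y => ('D_v f y, 'D_v g y))}.
  exact: (cvg_pair (cdf v) (cdg v)).
apply: continuous_near_eq C; apply: (near_open_eq Uo Ux) => y Uy.
have [dfy _] := cf y Uy; have [dgy _] := cg y Uy.
exact/esym/derive_pair.
Qed.

Lemma norm_pair0l (b : V2) : `|((0 : V1), b)| = `|b|.
Proof. by rewrite prod_normE /= normr0 max_r. Qed.

Lemma norm_pair0r (a : V1) : `|(a, (0 : V2))| = `|a|.
Proof. by rewrite prod_normE /= normr0 max_l. Qed.

Lemma C1_on_id (U : set V) : C1_on U id.
Proof.
move=> x _; split; first by have [] := is_diff_id x.
move=> v; have -> : 'D_v (@id V) = cst v by apply/funext => y; exact: derive_id.
exact: cst_continuous.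
Qed.

End PairMaps.

Lemma ball_pair (R : realType) (V1 V2 : normedModType R) (a : V1) (r : R)
    (x : V1) (y : V2) :
  ball a r x -> `|y| < r -> ball ((a, 0) : V1 * V2) r (x, y).
Proof.
by move=> ax yr; split => //=; rewrite -ball_normE /= sub0r normrN.
Qed.

Lemma mulmx_fixed_sub (R : realType) d (eta : 'rV[R]_d) (A B : 'M[R]_d) :
  eta *m A = eta -> eta *m B = eta - eta *m (A - B).
Proof. by move=> eA; rewrite mulmxBr eA opprB addrC subrK. Qed.

Section PushedVelocity.
Context {R : realType} {d m : nat}.
Variables (c : 'I_m -> 'rV[R]_d -> R) (f : 'rV[R]_d -> R).
Hypotheses (sc : forall i, smooth_on setT (c i)) (sf : smooth_on setT f).
Variables (U : set ('rV[R]_d * 'rV[R]_d)) (G : 'rV[R]_d * 'rV[R]_d -> 'rV[R]_d).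
Variables (xs : 'rV[R]_d) (mu L sb : R).
Hypotheses (Uo : open U) (Uxs : U (xs, 0)) (sG : smooth_on U G).
Hypotheses (rxs : regular c xs) (gxs : rgrad c f xs = 0).
Hypotheses (mu0 : 0 < mu) (L0 : 0 < L) (sb0 : 0 <= sb).

Local Notation P := (tan_proj c).
Local Notation grd := (rgrad c f).
Local Notation V2 := ('rV[R]_d * 'rV[R]_d)%type.

Let crd := coordinates_prod R d d.

Let cG : C1_on U G.
Proof. exact: (C1_on_C_class_mx crd Uo (sG 1)). Qed.

(** One constant dominates all the local bounds, the dimension and the data, so
    that the error estimate only has to count powers of it. *)
Lemma local_constants : exists K : R,
  [/\ 1 <= K, d%:R <= K, mu <= K, L^-1 <= K & sb <= K] /\
  (\forall y \near xs, regular c y /\ [/\ `|P y| <= K,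
     forall v, `|'D_v P y| <= K * `|v| & forall v, `|'D_v grd y| <= K * `|v|]) /\
  exists2 r, 0 < r & forall p, ball ((xs, 0) : V2) r p -> U p /\
    (forall v, `|'D_v G p| <= K * `|v|) /\
    forall q v, ball ((xs, 0) : V2) r q ->
      `|'D_v G p - 'D_v G q| <= K * `|v| * `|p - q|.
Proof.
have Ro := open_regular sc; have cP := tan_proj_C1_on sc; have cr := rgrad_C1_on sc sf.
have crV := coordinates_rV R d.
have [K1 K10 H1] := near_derive_bound crV Ro rxs cP.
have [K2 K20 H2] := near_derive_bound crV Ro rxs cr.
have [K3 K30 H3] := near_derive_bound crd Uo Uxs cG.
have [K4 K40 [r4 r40 H4]] := derive_lipschitz crd Uo Uxs (sG 2).
have HP : \forall y \near xs, `|P y| <= `|P xs| + 1.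
  have /cvgrPdist_le/(_ _ ltr01) := C1_on_continuous cP rxs.
  apply: filterS => y; rewrite distrC => Hy; rewrite -[P y](subrK (P xs)) addrC.
  by apply: le_trans (ler_normD _ _) _; rewrite lerD2l.
have L10 : 0 <= L^-1 by rewrite invr_ge0 ltW.
move: (L^-1) L10 => Li L10.
have mu0' := ltW mu0.
move: sb0 => s0; move: (sb) s0 => s s0.
pose K := 1 + d%:R + mu + Li + s + K1 + K2 + K3 + K4 + (`|P xs| + 1).
have d0 : 0 <= d%:R :> R by [].
have p0 : 0 <= `|P xs| by [].
have [Ka Kb Kc Kd] : [/\ K1 <= K, K2 <= K, K3 <= K & K4 <= K].
  by rewrite /K; split; lra.
have Ke : `|P xs| + 1 <= K by rewrite /K; lra.
exists K; split; first by rewrite /K; split; lra.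
split.
  have Rn : \forall y \near xs, regular c y by exact: open_nbhs_nbhs.
  have H123 := filterI Rn (filterI HP (filterI H1 H2)).
  have {}H123 := H123 (nbhs_filter xs) (nbhs_filter xs) (nbhs_filter xs).
  refine (@filterS _ _ (nbhs_filter xs) _ _ _ H123) => y [ry [Py [h1 h2]]].
  split => //; split.
  - exact: le_trans Py Ke.
  - by move=> v; apply: le_trans (h1 v) _; exact: ler_wpM2r.
  by move=> v; apply: le_trans (h2 v) _; exact: ler_wpM2r.
have [r3 /= r30 rU] := (nbhs_ballP _ _).1 (filterI (open_nbhs_nbhs (conj Uo Uxs)) H3).
exists (Num.min r3 r4); first by rewrite lt_min r30 r40.
move=> p pr; have p3 : ball ((xs, 0) : V2) r3 p.
  by apply: le_ball pr; rewrite ge_min lexx.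
have p4 : ball ((xs, 0) : V2) r4 p by apply: le_ball pr; rewrite ge_min lexx orbT.
have [Up h3] := rU p p3; split; first exact: Up.
split.
  by move=> v; apply: le_trans (h3 v) _; exact: ler_wpM2r.
move=> q v qr; have q4 : ball ((xs, 0) : V2) r4 q.
  by apply: le_ball qr; rewrite ge_min lexx orbT.
apply: le_trans (H4 p q v p4 q4) _; apply: ler_wpM2r => //; exact: ler_wpM2r.
Qed.

(** The search direction at y when the reflection is replaced by a fixed matrix
    S: the eigenvectors may not depend smoothly on the point, whereas this field
    does, and it agrees with the actual one at the point where S is taken. *)
Definition frozen_step (S : 'M[R]_d) (y : 'rV[R]_d) : 'rV[R]_d :=
  - (grd y *m S *m P y).

Lemma frozen_step_C1_on S : C1_on (regular c) (frozen_step S).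
Proof.
have Ro := open_regular sc; have cP := tan_proj_C1_on sc; have cr := rgrad_C1_on sc sf.
have cw := C1_on_mulmx Ro (C1_on_mulmx Ro cr (C1_on_cst S)) cP.
have -> : frozen_step S = fun y => (cst (-1) y : R) *: (grd y *m cst S y *m P y).
  by apply/funext => y; rewrite /= scaleN1r.
exact: (C1_onZ Ro (C1_on_cst _) cw).
Qed.

Lemma derive_frozen_step S y v : regular c y -> 'D_v (frozen_step S) y =
  - ('D_v grd y *m S *m P y + grd y *m S *m 'D_v P y).
Proof.
move=> ry; have Ro := open_regular sc.
have [dP _] := tan_proj_C1_on sc ry; have [dr _] := rgrad_C1_on sc sf ry.
have crS := C1_on_mulmx Ro (rgrad_C1_on sc sf) (C1_on_cst S).
have [drS _] := crS y ry.
have [dw _] := C1_on_mulmx Ro crS (tan_proj_C1_on sc) ry.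
have -> : 'D_v (frozen_step S) y = - 'D_v (fun z => grd z *m S *m P z) y.
  by rewrite -deriveN //; exact: diff_derivable dw.
congr (- _); rewrite (derive_mulmx v drS dP); congr (_ *m _ + _).
rewrite (derive_mulmx v dr (differentiable_cst S y)) derive_cst.
by rewrite mulmx0 addr0.
Qed.

Local Notation step := frozen_step.

Lemma near_small (eps : R) : 0 < eps -> \forall y \near xs,
  [/\ `|grd y| <= eps, `|P y - P xs| <= eps &
   forall v, `|'D_v grd y - 'D_v grd xs| <= eps * `|v|].
Proof.
move=> eps0; have Ro := open_regular sc.
have cP := tan_proj_C1_on sc; have cr := rgrad_C1_on sc sf.
have H1 := near_derive_dist (coordinates_rV R d) Ro rxs cr eps0.
have H2 : \forall y \near xs, `|P y - P xs| <= eps.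
  have /cvgrPdist_le/(_ _ eps0) := C1_on_continuous cP rxs.
  apply: filterS => y Hy.
  exact: (eq_ind_r (fun z => z <= eps) Hy (distrC (P y) (P xs))).
have H3 : \forall y \near xs, `|grd y| <= eps.
  have /cvgrPdist_le/(_ _ eps0) := C1_on_continuous cr rxs.
  have E y : `|grd xs - grd y| = `|grd y| by rewrite gxs sub0r normrN.
  apply: filterS => y Hy.
  exact: (eq_ind_r (fun z => z <= eps) Hy (esym (E y))).
have H := filterI H3 (filterI H2 H1).
have {}H := H (nbhs_filter xs) (nbhs_filter xs).
by refine (@filterS _ _ (nbhs_filter xs) _ _ _ H) => y [h3 [h2 h1]].
Qed.

(** Near the saddle point the differential of one frozen step is the identity
    minus t times the flipped Hessian at x, with an error at most t e, where e
    is as small as desired and the neighborhood does not depend on t or S. The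
    retraction enters through its extension G, of which only the derivatives at
    the zero section along tangent vectors are known exactly. *)
Lemma pushed_velocity (e : R) : 0 < e -> exists2 r, 0 < r &
  forall (t : R) (S : 'M[R]_d), 0 < t -> t <= L^-1 -> `|S| <= sb ->
  [/\ C1_on (ball xs r) (fun z => G (z, t *: step S z)),
      forall z, ball xs r z -> [/\ regular c z, U (z, 0) & U (z, t *: step S z)] &
      forall x y eta, ball xs r x -> ball xs r y -> S *m P x = P x *m S ->
        eta *m P y = eta -> 'D_((eta, 0)) G (y, 0) = eta ->
        (forall th, th *m P y = th -> 'D_((0, th)) G (y, 0) = th) ->
        `|'D_eta (fun z => G (z, t *: step S z)) y -
           eta *m (1%:M - t *: (P x *m rhess c f x *m S + mu *: (1%:M - P x)))|
          <= t * (e * `|eta|)].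
Proof.
move=> e0.
have [K [[K1 dK muK LK sbK] [Hn [r2 r20 HG]]]] :=
  local_constants.
have Kp : 0 < K by apply: lt_le_trans K1.
(* the first bound absorbs the error estimate, the second one keeps the
   displaced points in the ball where G is controlled *)
pose eps := Num.min 1 (Num.min (e / (14 * K ^+ 11)) (r2 / (2 * K ^+ 5))).
have K11 : 0 < 14 * K ^+ 11 by rewrite mulr_gt0 // exprn_gt0.
have K5 : 0 < 2 * K ^+ 5 by rewrite mulr_gt0 // exprn_gt0.
have eps0 : 0 < eps by rewrite !lt_min ltr01 !divr_gt0.
have eps1 : eps <= 1 by rewrite ge_min lexx.
have epse : 14 * K ^+ 11 * eps <= e.
  by rewrite mulrC -ler_pdivlMr // !ge_min lexx orbT.
have epsr : K * (K ^+ 4 * eps) < r2.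
  have h : 2 * K ^+ 5 * eps <= r2 by rewrite mulrC -ler_pdivlMr // !ge_min lexx !orbT.
  have h2 : 0 < K ^+ 5 * eps by rewrite mulr_gt0 // exprn_gt0.
  by rewrite mulrA -exprS; lra.
have Hb : \forall y \near xs, ball xs r2 y by exact: nbhsx_ballx.
have H := filterI Hb (filterI Hn (near_small eps0)).
have {}H := H (nbhs_filter xs) (nbhs_filter xs).
have [r /= r0 rH] := (nbhs_ballP _ _).1 H.
exists r; first exact: r0.
move=> t S t0 tL SK.
have tK : t <= K by exact: le_trans LK.
have {}SK : `|S| <= K by exact: le_trans sbK.
have wle z : ball xs r z -> `|step S z| <= K ^+ 4 * eps.
  move=> /rH [_ [[rz [Pz _ _]] [gz _ _]]]; rewrite normrN.
  exact: (displacement_bound dK SK Pz gz).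
have tw z : ball xs r z -> `|t *: step S z| <= t * (K ^+ 4 * eps).
  by move=> /wle zw; rewrite normrZ gtr0_norm // ler_pM2l.
have twr z : ball xs r z -> `|t *: step S z| < r2.
  move=> /tw zw; apply: le_lt_trans zw _; apply: le_lt_trans epsr.
  by apply: ler_wpM2r => //; rewrite mulr_ge0 ?exprn_ge0 // ltW.
have inb z : ball xs r z ->
    ball ((xs, 0) : 'rV[R]_d * 'rV[R]_d) r2 (z, t *: step S z).
  by move=> zr; have [zr2 _] := rH z zr; apply: ball_pair => //; exact: twr.
have inb0 z : ball xs r z -> ball ((xs, 0) : 'rV[R]_d * 'rV[R]_d) r2 (z, 0).
  by move=> zr; have [zr2 _] := rH z zr; apply: ball_pair => //; rewrite normr0.
have bo : open (ball xs r) by exact: ball_open.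
have breg : ball xs r `<=` regular c by move=> z /rH[_ [[]]].
have cw : C1_on (ball xs r) (fun z => (z, t *: step S z)).
  apply: (C1_on_pair bo (@C1_on_id _ _ _)).
  apply: (C1_onZ bo (C1_on_cst t)).
  exact: (C1_on_sub breg (frozen_step_C1_on S)).
have inU z : ball xs r z -> U (z, t *: step S z) by move=> /inb /HG[].
have cGam : C1_on (ball xs r) (fun z => G (z, t *: step S z)).
  exact: (C1_on_comp crd bo inU cw cG).
split; first exact: cGam.
  by move=> z zr; split; [exact: breg|have [] := HG _ (inb0 z zr)|exact: inU].
move=> x y eta xr yr SP etaP De Dth.
have [_ [[rx [Px _ grx]] [_ Pxs gxs']]] := rH x xr.
have [_ [[ry [Py dPy gry]] [gy Pys gys]]] := rH y yr.
have PyPy := tan_proj_idem ry.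
have [_ [Gb Glip]] := HG _ (inb y yr).
have [_ [Gb0 _]] := HG _ (inb0 y yr).
set p := (y, t *: step S y) in Glip Gb *.
pose p0 : 'rV[R]_d * 'rV[R]_d := (y, 0).
have [dGp _] := cG (inU y yr); have [dGp0 _] := cG (HG _ (inb0 y yr)).1.
set zeta := 'D_eta (step S) y.
have Ez : zeta = - ('D_eta grd y *m S *m P y + grd y *m S *m 'D_eta P y).
  exact: derive_frozen_step.
have [dst _] := frozen_step_C1_on S ry.
have dst' : differentiable (fun z => t *: step S z) y by exact: differentiableZ.
have did : differentiable (@id 'rV[R]_d) y by have [] := is_diff_id y.
have [dcw _] := cw y yr.
have DGam : 'D_eta (fun z => G (z, t *: step S z)) y =
    'D_((eta, 0)) G p + t *: 'D_((0, zeta)) G p.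
  rewrite (derive_comp eta dcw dGp) (derive_pair eta did dst') derive_id.
  have -> : 'D_eta (fun z => t *: step S z) y = t *: zeta.
    exact: (deriveZ t (diff_derivable dst)).
  rewrite -(derive_scale t (0, zeta) dGp) -(derive_add _ _ dGp); congr ('D__ G p).
  by rewrite /= -[RHS]/(eta + t *: 0, 0 + t *: zeta) scaler0 addr0 add0r.
have [drx _] := rgrad_C1_on sc sf rx.
have main : eta *m (1%:M - t *: (P x *m rhess c f x *m S + mu *: (1%:M - P x))) =
    eta - t *: ('D_(eta *m P x) grd x *m S *m P x + mu *: (eta - eta *m P x)).
  have e1 : eta *m (P x *m rhess c f x *m S) = 'D_(eta *m P x) grd x *m S *m P x.
    rewrite 2!(mulmxA eta) (mul_rhess sc sf (eta *m P x) rx).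
    by rewrite -(mulmxA _ (P x) S) -SP mulmxA.
  have e2 : eta *m (mu *: (1%:M - P x)) = mu *: (eta - eta *m P x).
    by rewrite -scalemxAr (mulmxBr eta 1%:M (P x)) mulmx1.
  move: e1 e2; set A1 := P x *m _ *m S; set A2 := mu *: (1%:M - _) => e1 e2.
  by rewrite mulmxBr mulmx1 -scalemxAr mulmxDr e1 e2.
rewrite DGam main.
have pp0 : `|p - p0| <= t * (K ^+ 4 * eps).
  have -> : p - p0 = (0, t *: step S y).
    by rewrite -[LHS]/(y - y, t *: step S y - 0) subrr subr0.
  by rewrite norm_pair0l; exact: tw.
have n0 : 0 <= `|eta| by [].
have eps2 : 2 * eps = eps + eps by ring.
have PP : `|P x - P y| <= 2 * eps.
  rewrite -(subrKA (P xs) (P x) (- P y)) eps2; apply: le_trans (ler_normD _ _) _.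
  by apply: lerD; [exact: Pxs|rewrite (distrC (P xs)); exact: Pys].
have rr : `|'D_(eta *m P x) grd x - 'D_eta grd y| <= 4 * K ^+ 2 * eps * `|eta|.
  have PP' : `|P y - P x| <= 2 * eps by rewrite (distrC (P y)).
  have Ex : eta *m P x = eta - eta *m (P y - P x).
    exact: mulmx_fixed_sub etaP.
  have Dx : 'D_(eta *m P x) grd x = 'D_eta grd x - 'D_(eta *m (P y - P x)) grd x.
    apply: etrans (congr1 (fun z => 'D_z grd x) Ex) _.
    by rewrite (derive_add eta _ drx) -scaleN1r (derive_scale _ _ drx) scaleN1r.
  apply: (eq_ind_r (fun z => `|z - 'D_eta grd y| <= _) _ Dx).
  have b1 : `|'D_(eta *m (P y - P x)) grd x| <= 2 * K ^+ 2 * eps * `|eta|.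
    apply: le_trans (grx _) _; apply: le_trans (ler_wpM2l (ltW Kp)
      (mulmx_norm_le dK (lexx `|eta|) PP')) _.
    by rewrite [leLHS](_ : _ = 2 * K ^+ 2 * eps * `|eta|) //; ring.
  have b2 : `|'D_eta grd x - 'D_eta grd y| <= 2 * eps * `|eta|.
    rewrite -(subrKA ('D_eta grd xs) ('D_eta grd x) (- 'D_eta grd y)).
    apply: le_trans (ler_normD _ _) _.
    rewrite eps2 mulrDl; apply: lerD; first exact: gxs'.
    by rewrite (distrC ('D_eta grd xs)); exact: gys.
  rewrite addrAC; apply: le_trans (ler_normB _ _) _.
  apply: le_trans (lerD b2 b1) _.
  have K2 : 1 <= K ^+ 2 by exact: exprn_ege1.
  have en0 : 0 <= eps * `|eta| by rewrite mulr_ge0 // ltW.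
  rewrite [leLHS](_ : _ = (2 + 2 * K ^+ 2) * (eps * `|eta|)); last by ring.
  rewrite [leRHS](_ : _ = (4 * K ^+ 2) * (eps * `|eta|)); last by ring.
  apply: ler_wpM2r => //; rewrite (_ : 4 * K ^+ 2 = 2 * K ^+ 2 + 2 * K ^+ 2).
    by rewrite lerD2r ler_peMr.
  by ring.
apply: (@le_trans _ _ (t * (14 * K ^+ 11 * (eps * `|eta|)))); last first.
  by rewrite ler_pM2l // mulrA; apply: ler_wpM2r.
have tKe : 0 <= t * (K ^+ 4 * eps) by rewrite !mulr_ge0 ?exprn_ge0 // ltW.
have B1 : `|'D_((eta, 0)) G p - eta| <= K * `|eta| * (t * (K ^+ 4 * eps)).
  have := Glip _ (eta, 0) (inb0 y yr); rewrite norm_pair0r => H0.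
  apply: le_trans (eq_ind _ (fun z => `|'D_((eta, 0)) G p - z| <= _) H0 _ De) _.
  by apply: ler_wpM2l => //; rewrite mulr_ge0 // ltW.
have B3 : `|'D_((0, zeta)) G p - 'D_((0, zeta)) G p0| <=
    K * `|zeta| * (t * (K ^+ 4 * eps)).
  have := Glip _ (0, zeta) (inb0 y yr); rewrite norm_pair0l => H0.
  by apply: le_trans H0 _; apply: ler_wpM2l => //; rewrite mulr_ge0 // ltW.
have B2 : `|'D_((0, zeta)) G p0 - zeta *m P y| <= K * `|zeta - zeta *m P y|.
  have zPP : zeta *m P y *m P y = zeta *m P y by rewrite -mulmxA PyPy.
  have Dz : 'D_((0, zeta)) G p0 - 'D_((0, zeta *m P y)) G p0 =
      'D_((0, zeta - zeta *m P y)) G p0.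
    have -> : ((0, zeta - zeta *m P y) : 'rV[R]_d * 'rV[R]_d) =
        (0, zeta) + (-1) *: (0, zeta *m P y).
      rewrite -[RHS]/(0 + (-1) *: 0, zeta + (-1) *: (zeta *m P y)).
      by rewrite scaler0 addr0 scaleN1r.
    by rewrite (derive_add _ _ dGp0) (derive_scale _ _ dGp0) scaleN1r.
  have Dz' := etrans (congr1 (fun z => 'D_((0, zeta)) G p0 - z) (esym (Dth _ zPP))) Dz.
  apply: (eq_ind_r (fun z => `|z| <= _) _ Dz').
  by apply: le_trans (Gb0 _) _; rewrite norm_pair0l.
clearbody zeta; subst zeta.
exact: (velocity_error K1 dK (ltW eps0) eps1 n0 (ltW mu0) muK (lexx _) SK Px Py
  (dPy eta) (gry eta) rr gy PP etaP PyPy (ltW t0) tK B1 B2 B3).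
Qed.

End PushedVelocity.

(** * One step contracts the geodesic distance *)

Section Geodesic.
Context {R : realType} {d m : nat}.
Variable c : 'I_m -> 'rV[R]_d -> R.

Lemma geodist_ge0 x y : (0 <= geodist c x y)%E.
Proof.
apply/ereal_infP => _ [g _ <-]; apply: integral_ge0 => t _.
by rewrite lee_fin enorm_ge0.
Qed.

Lemma enorm_le_geodist x y : ((enorm (y - x))%:E <= geodist c x y)%E.
Proof.
apply/ereal_infP => _ [g [cg _ <- <- [s gs]] <-].
exact: (@displacement_le_length _ _ _ s).
Qed.

(** A family of pushed curves that contracts lengths contracts the distance,
    even if only short curves can be pushed: longer ones do not matter for the
    infimum. *)
Lemma geodist_contraction x x' y (q eps : R) : 0 < q ->
  (geodist c x y < eps%:E)%E ->
  (forall g, admissible_curve c x y g -> (curve_length g < eps%:E)%E ->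
     exists2 g', admissible_curve c x' y g' &
       (curve_length g' <= q%:E * curve_length g)%E) ->
  (geodist c x' y <= q%:E * geodist c x y)%E.
Proof.
move=> q0 xy push; rewrite -lee_pdivrMl //; apply/ereal_infP => _ [g ag <-].
have short h : admissible_curve c x y h -> (curve_length h < eps%:E)%E ->
    (q^-1%:E * geodist c x' y <= curve_length h)%E.
  move=> ah hl; have [h' ah' hh'] := push h ah hl.
  rewrite lee_pdivrMl //; apply: le_trans hh'.
  by apply: ereal_inf_lbound; exists h'.
have [gl|gl] := ltP (curve_length g) eps%:E; first exact: short.
have /ereal_inf_ltP[_ [h ah <-] hl] := xy.
exact: le_trans (short h ah hl) (le_trans (ltW hl) gl).
Qed.

End Geodesic.

Section RetractionDerivatives.
Context {R : realType} {d m : nat}.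
Variables (c : 'I_m -> 'rV[R]_d -> R) (Ret : 'rV[R]_d -> 'rV[R]_d -> 'rV[R]_d).
Variables (U : set ('rV[R]_d * 'rV[R]_d)) (G : 'rV[R]_d * 'rV[R]_d -> 'rV[R]_d).
Hypotheses (Uo : open U) (cG : C1_on U G).
Hypothesis GRet : forall p, U p -> manifold c p.1 /\ (p.2 <= tangent c p.1)%MS ->
  G p = Ret p.1 p.2.

(** Only velocities of curves in the manifold can be tested: along such a curve
    the extension G restricted to the zero section is the identity. *)
Lemma retraction_base_derivative (g : R -> 'rV[R]_d) (t : R) :
  (forall x, manifold c x -> Ret x 0 = x) ->
  (forall z : R, `[0, 1]%classic z -> manifold c (g z) /\ U (g z, 0)) ->
  `]0, 1[%classic t -> derivable g t 1 ->
  'D_((derive1 g t, 0)) G (g t, 0) = derive1 g t.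
Proof.
move=> R0 gz t01 dg.
have dg' := (derivable1_diffP _ _).1 dg.
have dc0 : differentiable (fun _ : R => 0 : 'rV[R]_d) t by exact: differentiable_cst.
have [_ Ut] := gz t (subset_itv_oo_cc t01); have [dG _] := cG Ut.
have dp : differentiable (fun z => (g z, 0 : 'rV[R]_d)) t by exact: differentiable_pair.
have E : 'D_1 (G \o (fun z => (g z, 0 : 'rV[R]_d))) t = 'D_1 g t.
  apply: near_eq_derive; apply: (near_open_eq (interval_open _ _) t01) => // z z01.
  have [Mz Uz] := gz z (subset_itv_oo_cc z01).
  by rewrite /= (GRet Uz) //=; [exact: R0|split => //; exact: sub0mx].
rewrite derive1E -[RHS]E (derive_comp (1 : R) dp dG) (derive_pair (1 : R) dg' dc0).
by rewrite derive_cst.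
Qed.

Lemma retraction_fiber_derivative (y th : 'rV[R]_d) :
  (forall x eta, manifold c x -> (eta <= tangent c x)%MS ->
    is_derive (0 : R) (1 : R) (fun t : R => Ret x (t *: eta)) eta) ->
  manifold c y -> U (y, 0) -> (th <= tangent c y)%MS ->
  'D_((0, th)) G (y, 0) = th.
Proof.
move=> dR My Uy thT; have [_ dth] := dR y th My thT; apply: etrans _ dth.
have line (t : R) : t *: ((0, th) : 'rV[R]_d * 'rV[R]_d) + (y, 0) = (y, t *: th).
  by rewrite -[LHS]/(t *: 0 + y, t *: th + 0) scaler0 add0r addr0.
have [dG _] := cG Uy; have dGv := diff_derivable (v := (0, th)) dG.
have l0 : (0 : R) *: ((0, th) : 'rV[R]_d * 'rV[R]_d) + (y, 0) = (y, 0).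
  by rewrite line scale0r.
rewrite -[X in derivable _ X _]l0 in dGv; have [_ dl] := is_derive_line dGv.
rewrite l0 in dl; apply: etrans (esym dl) _; apply: near_eq_derive.
have cl : {for (0 : R), continuous (fun t : R => (y, t *: th))}.
  apply: differentiable_continuous; apply: differentiable_pair.
    exact: differentiable_cst.
  by have [] := is_diff_scalel (0 : R) th.
have : \forall t \near (0 : R), U (y, t *: th).
  by apply: cl; apply: open_nbhs_nbhs; split; rewrite ?scale0r.
apply: filterS => t Ut; rewrite line (GRet Ut) //; split => //=.
exact: scalemx_sub.
Qed.

End RetractionDerivatives.

Section OneStep.
Context {R : realType} {d m k : nat}.
Variables (f : 'rV[R]_d -> R) (c : 'I_m -> 'rV[R]_d -> R).
Variables (Ret : 'rV[R]_d -> 'rV[R]_d -> 'rV[R]_d) (xs : 'rV[R]_d) (L mu : R).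
Hypotheses (sf : smooth_on setT f) (sc : forall i, smooth_on setT (c i)).
Hypothesis free : forall x, manifold c x -> row_free (constraint_grads c x).
Hypothesis retr : is_retraction c Ret.
Hypotheses (kd : (k < d - m)%N) (Mxs : manifold c xs) (gxs : rgrad c f xs = 0).
Hypotheses (mu0 : 0 < mu) (muL : mu < L).

Local Notation P := (tan_proj c).
Local Notation step := (frozen_step c f).

Lemma step_tangent S y : manifold c y -> (step S y <= tangent c y)%MS.
Proof.
by move=> My; rewrite /frozen_step -mulNmx; apply: tan_proj_sub; exact: free.
Qed.

(** The reflection commutes with the projector at its own base point, so the
    frozen field has there the value used by the iteration. *)
Lemma step_saddle_direction x (v : 'I_k -> 'rV[R]_d) : manifold c x ->
  (forall i, (v i <= tangent c x)%MS) ->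
  step (reflection v) x = - saddle_direction c f x v.
Proof.
move=> Mx vT; have rx : regular c x by apply: gram_unitmx; exact: free.
have vP i : v i *m P x = v i by exact: tan_proj_id.
have SP := reflection_comm (tan_proj_sym c x) vP.
rewrite /frozen_step /saddle_direction -/(reflection v); congr (- _).
by rewrite -mulmxA SP mulmxA {1}/rgrad -(mulmxA (nabla f x)) tan_proj_idem.
Qed.

(** A short curve from x to xs is pushed by y |-> Ret y (t *: step S y), with S
    the reflection at x. The pushed curve joins the next iterate to xs, a fixed
    point since the gradient vanishes there, and its speed is smaller by the
    factor 1 - t mu / 2, half of the contraction of the flipped Hessian being
    left to absorb the error. *)
Lemma geodist_step : exists2 r, 0 < r &
  forall (t : R) x (v : 'I_k -> 'rV[R]_d) (lam : (d - m).-tuple R),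
  0 < t -> t <= L^-1 -> manifold c x -> (geodist c x xs < r%:E)%E ->
  hess_spectrum c f x lam ->
  (forall i, (i < d - m)%N ->
     if (i < k)%N then - L <= lam`_i <= - mu else mu <= lam`_i <= L) ->
  smallest_eigenvectors c f x v ->
  manifold c (Ret x (- t *: saddle_direction c f x v)) /\
  (geodist c (Ret x (- t *: saddle_direction c f x v)) xs <=
     (1 - t * mu / 2)%:E * geodist c x xs)%E.
Proof.
have L0 : 0 < L by exact: lt_trans muL.
have [RM Rs R0 dR] := retr.
have [|U [G [Uo Uxs sG GRet]]] := Rs (xs, 0).
  by split => //=; exact: sub0mx.
have rxs : regular c xs by apply: gram_unitmx; exact: free.
pose sb : R := 1 + 2 * k%:R * d%:R.
have sb0 : 0 <= sb by rewrite addr_ge0 // !mulr_ge0.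
(* going from the sup norm back to the Euclidean norm costs a factor d *)
pose e := mu / (2 * d.+1%:R).
have d1 : (0 : R) < 2 * d.+1%:R by rewrite mulr_gt0.
have e0 : 0 < e by rewrite divr_gt0.
have de : d%:R * e <= mu / 2.
  rewrite /e mulrA ler_pdivrMr // mulrC.
  have -> : mu / 2 * (2 * d.+1%:R) = mu * d.+1%:R by field.
  by rewrite ler_pM2l // ler_nat.
have [r r0 Hr] := pushed_velocity sc sf Uo Uxs sG rxs gxs mu0 L0 sb0 e0.
have cG : C1_on U G.
  exact: (C1_on_C_class_mx (coordinates_prod R d d) Uo (sG 1)).
have GRet' p : U p -> manifold c p.1 /\ (p.2 <= tangent c p.1)%MS ->
    G p = Ret p.1 p.2 by exact: GRet.
exists r => // t x v lam t0 tL Mx xr sp bd ev.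
have [vT vON _] := ev.
pose S := reflection v.
have Ssb : `|S| <= sb by exact: reflection_norm.
have tL1 : t * L <= 1 by rewrite -ler_pdivlMr // div1r.
have SP : S *m P x = P x *m S.
  apply: reflection_comm; first exact: tan_proj_sym.
  by move=> i; exact: tan_proj_id.
have E' : - t *: saddle_direction c f x v = t *: step S x.
  by rewrite step_saddle_direction // scalerN scaleNr.
rewrite {}E'.
split; first by apply: RM => //; apply: scalemx_sub; exact: step_tangent.
have [cGam Hin Hvel] := Hr t S t0 tL Ssb.
set Gam := fun z => G (z, t *: step S z) in cGam.
have q0 : 0 < 1 - t * mu / 2.
  have : t * mu < t * L by rewrite ltr_pM2l.
  by rewrite -mulrA; move: tL1; rewrite mulrA; lra.
have GamRet y : ball xs r y -> manifold c y -> Gam y = Ret y (t *: step S y).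
  move=> yr My; have [_ _ Uy] := Hin y yr; rewrite /Gam GRet' //.
  by split => //=; apply: scalemx_sub; exact: step_tangent.
apply: (geodist_contraction q0 xr) => g ag gl.
have [cg gM g0 g1 [s gs]] := ag.
have inb (z : R) : `[0, 1]%classic z -> ball xs r (g z).
  rewrite /= in_itv /= => /andP[z0 z1]; rewrite -ball_normE /= -g1.
  apply: le_lt_trans (norm_le_enorm _) _; rewrite -lte_fin.
  by apply: le_lt_trans (displacement_le_length cg gs z0 z1 (lexx 1)) gl.
have [cGg dGg] := push_curve_C1_off cGam gs inb.
have I0 : `[0, 1]%classic (0 : R) by rewrite /= in_itv /= lexx ler01.
have I1 : `[0, 1]%classic (1 : R) by rewrite /= in_itv /= lexx ler01.
exists (Gam \o g).
  split.
  - apply/subspace_continuousP => z zin.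
    have cgz := (subspace_continuousP _ _).1 cg z zin.
    exact: cvg_comp cgz (C1_on_continuous cGam (inb z zin)).
  - move=> z z01; rewrite /= GamRet; [|exact: inb|exact: gM].
    apply: RM; first exact: gM.
    by apply: scalemx_sub; apply: step_tangent; exact: gM.
  - by rewrite /= g0 GamRet //; rewrite -g0; exact: inb.
  - rewrite /= g1 GamRet //; last exact: ballxx.
    by rewrite /frozen_step gxs !mul0mx oppr0 scaler0; exact: R0.
  by exists s.
apply: (length_le_scale (ltW q0) gs cGg) => z z01 zs.
have zcc := subset_itv_oo_cc z01.
have [dgz _] := gs z z01 zs.
have etaT := velocity_tangent sc gM z01 dgz.
set eta := derive1 g z in etaT *.
have De : 'D_((eta, 0)) G (g z, 0) = eta.
  apply: (retraction_base_derivative cG GRet' R0) => // w w01.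
  by have [_ Uw _] := Hin _ (inb w w01); split => //; exact: gM.
have ry : regular c (g z) by have [] := Hin _ (inb z zcc).
have Dth th : th *m P (g z) = th -> 'D_((0, th)) G (g z, 0) = th.
  move=> thP; have [_ Uz _] := Hin _ (inb z zcc).
  apply: (retraction_fiber_derivative Uo cG GRet' dR) => //; first exact: gM.
  by rewrite tangentE // thP.
have xb : ball xs r x by rewrite -g0; exact: inb.
have := Hvel x (g z) eta xb (inb z zcc) SP (tan_proj_id etaT) De Dth.
rewrite -[P x *m _ *m S + _]/(flipped (P x) (rhess c f x) v mu) -/Gam.
rewrite (dGg z z01 zs) -/eta; set D := 'D_eta Gam (g z).
set F := eta *m _ => DF.
have Fc : enorm F <= (1 - t * mu) * enorm eta.
  by apply: (hessian_contraction sc sf eta (free Mx) kd mu0 muL (ltW t0) tL1 sp bd ev).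
rewrite -(subrK F D); apply: le_trans (enormD _ _) _.
have De2 : enorm (D - F) <= t * (mu / 2) * enorm eta.
  apply: le_trans (enorm_le_norm _) _.
  apply: le_trans (ler_wpM2l (ler0n _ d) DF) _.
  have h1 : d%:R * e * `|eta| <= mu / 2 * enorm eta.
    by apply: ler_pM => //; [rewrite mulr_ge0 // ltW|exact: norm_le_enorm].
  rewrite [leLHS](_ : _ = t * (d%:R * e * `|eta|)); last by ring.
  by rewrite -[leRHS]mulrA ler_pM2l.
apply: le_trans (lerD De2 Fc) _.
by rewrite -mulrDl; apply: ler_wpM2r; [exact: enorm_ge0|lra].
Qed.

End OneStep.

(** * Linear convergence of the iteration *)

Theorem proposition4p6 (R : realType) :
  exists rate : R -> R -> R,
    (forall kappa h : R, 1 < kappa -> 0 < h <= 1 -> 0 <= rate kappa h < 1) /\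
    forall (d m k : nat) (f : 'rV[R]_d -> R) (c : 'I_m -> 'rV[R]_d -> R)
      (Ret : 'rV[R]_d -> 'rV[R]_d -> 'rV[R]_d) (xs : 'rV[R]_d)
      (delta L mu : R),
    smooth_on setT f ->
    (forall i, smooth_on setT (c i)) ->
    (forall x, manifold c x -> row_free (constraint_grads c x)) ->
    is_retraction c Ret ->
    strict_saddle_point c f k xs ->
    0 < delta -> 0 < mu -> mu < L ->
    (forall x, geoball c xs delta x ->
      exists2 lam, hess_spectrum c f x lam &
        forall i, (i < d - m)%N ->
          if (i < k)%N then - L <= lam`_i <= - mu else mu <= lam`_i <= L) ->
    exists2 eps : R, 0 < eps &
      forall (dt : R) (x : nat -> 'rV[R]_d) (v : nat -> 'I_k -> 'rV[R]_d),
        0 < dt -> dt <= L^-1 ->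
        geoball c xs eps (x 0%N) ->
        (forall n, smallest_eigenvectors c f (x n) (v n)) ->
        (forall n, x n.+1 =
          Ret (x n) (- dt *: saddle_direction c f (x n) (v n))) ->
        x @ \oo --> xs /\
        forall n, (geodist c (x n.+1) xs <=
          (rate (L / mu) (L * dt))%:E * geodist c (x n) xs)%E.
Proof.
(* with kappa = L / mu and h = L dt this is 1 - dt mu / 2 *)
exists (fun kappa h => 1 - h / kappa / 2); split.
  move=> kappa h k1 /andP[h0 h1]; have k0 : 0 < kappa by exact: lt_trans k1.
  have hk : h / kappa <= 1 by rewrite ler_pdivrMr // mul1r (le_trans h1) // ltW.
  have hk0 : 0 < h / kappa by rewrite divr_gt0.
  by move: hk hk0; set z := h / kappa => hk hk0; apply/andP; split; lra.
move=> d m k f c Ret xs delta L mu sf sc free retr [[kd Mxs gxs _] _] delta0 mu0 muL bd.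
have L0 : 0 < L by exact: lt_trans muL.
have [r r0 Hr] := geodist_step sf sc free retr kd Mxs gxs mu0 muL.
exists (Num.min delta r); first by rewrite lt_min delta0 r0.
move=> dt x v dt0 dtL [Mx0 x0eps] ev xS.
set eps := Num.min delta r in x0eps.
have eps0 : 0 < eps by rewrite lt_min delta0 r0.
have rateE : 1 - L * dt / (L / mu) / 2 = 1 - dt * mu / 2.
  by congr (1 - _ / 2); field; rewrite !gt_eqF.
rewrite /= rateE.
have dtmu : 0 < dt * mu < 1.
  rewrite mulr_gt0 //=; have : dt * mu < dt * L by rewrite ltr_pM2l.
  by move=> /lt_le_trans; apply; rewrite -ler_pdivlMr // div1r.
set q := 1 - dt * mu / 2.
have [q0 q1] : 0 < q /\ q < 1.
  by rewrite /q; move: dtmu; set z := dt * mu => /andP[z0 z1]; split; lra.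
have one n : manifold c (x n) -> (geodist c (x n) xs < eps%:E)%E ->
    manifold c (x n.+1) /\ (geodist c (x n.+1) xs <= q%:E * geodist c (x n) xs)%E.
  move=> Mn xn; have xd : geoball c xs delta (x n).
    by split => //; apply: lt_le_trans xn _; rewrite lee_fin ge_min lexx.
  have [lam sp lb] := bd _ xd.
  rewrite xS; apply: (Hr dt (x n) (v n) lam) => //.
  by apply: lt_le_trans xn _; rewrite lee_fin ge_min lexx orbT.
have q0' : (0 <= q%:E)%E by rewrite lee_fin ltW.
have all n : manifold c (x n) /\ (geodist c (x n) xs < eps%:E)%E /\
    (geodist c (x n) xs <= (q ^+ n * eps)%:E)%E.
  elim: n => [|n [Mn [xn xqn]]].
    by split => //; split => //; rewrite expr0 mul1r ltW.
  have [MS xS'] := one n Mn xn; split => //; split.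
    apply: le_lt_trans xn; apply: le_trans xS' _.
    rewrite -[leRHS]mul1e; apply: lee_wpmul2r; first exact: geodist_ge0.
    by rewrite lee_fin ltW.
  apply: le_trans xS' _; rewrite exprS -mulrA EFinM.
  exact: lee_wpmul2l.
split; last by move=> n; have [Mn [xn _]] := all n; have [] := one n Mn xn.
have cq : geometric eps q @ \oo --> (0 : R).
  by apply: cvg_geometric; rewrite ger0_norm // ltW.
apply/cvgrPdist_le => e e0.
move/cvgrPdist_le : cq => /(_ _ e0); apply: filterS => n.
rewrite sub0r normrN /= => qn.
have [_ [_ xqn]] := all n.
apply: le_trans (norm_le_enorm _) _; rewrite -lee_fin.
apply: le_trans (enorm_le_geodist c (x n) xs) _.
apply: le_trans xqn _; rewrite lee_fin mulrC; apply: le_trans qn; exact: ler_norm.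
Qed.
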